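(* Let $q>0$ be an integer and $k=2q+1$. The graph resulting from the sum $k\,w_1+w_q$ of $k$ wheels $w_1$ and one wheel $w_q$ modulo two, summed according to the multiwheel pattern, is 4-critical and quadrangulates the projective plane.
   Context: All graphs are finite and simple. $w_q$ denotes the odd wheel $W_{2q+1}$, consisting of a cycle of length $2q+1$ (the rim) together with a hub joined to every rim vertex; in particular $w_1=W_3=K_4$. The edge sum modulo two of graphs placed on a common vertex set has as vertices the union of their vertex sets and as edges those edges which belong to an odd number of the graphs. The sum $k\,w_1+w_q$ according to the multiwheel pattern is the following. Let $w_q$ have hub $z$ and rim cycle $u_0u_1\cdots u_{k-1}$ (indices modulo $k$), let $v_0,\dots,v_{k-1}$ be further distinct vertices, and let the $i$-th wheel $w_1$ be the complete graph on $\{u_i,u_{i+1},v_i,v_{i+1}\}$. Then consecutive wheels $w_1$ share the edges $u_iv_i$, so each wheel $w_1$ loses two edges in common with its neighbouring wheels $w_1$ in the cyclic sequence, and in addition $w_q$ loses its $k$ rim edges $u_iu_{i+1}$, one with each wheel $w_1$. The resulting graph (edge sum modulo two) has vertices $z,u_i,v_i$ and edges $zu_i$, $v_iv_{i+1}$, $u_iv_{i+1}$, $u_{i+1}v_i$; it is the graph obtained by Mycielski's construction from the odd cycle $C_k$ (for $k=5$ it is the Grötzsch graph). A graph is 4-critical if its chromatic number is 4 and every proper subgraph has chromatic number at most 3. A graph quadrangulates the projective plane if it can be embedded in the projective plane so that every face is bounded by a cycle of length 4. *)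

(* Defs.v *)
From HB Require Import structures.
From mathcomp Require Import all_boot all_order all_algebra.
From mathcomp Require Import all_classical all_reals all_analysis.
Import Order.TTheory GRing.Theory Num.Theory.
Import numFieldNormedType.Exports.

Set Implicit Arguments.
Unset Strict Implicit.
Unset Printing Implicit Defensive.

Section Graphs.
Local Open Scope set_scope.
Variable T : finType.
Implicit Types (V : {set T}) (x y : T).

Definition pairs V : {set {set T}} :=
  [set e : {set T} | (e \subset V) && (#|e| == 2)].

Record graph := Graph {
  vset : {set T};
  eset : {set {set T}};
  eset_sub : eset \subset pairs vset
}.

(* Members of E that are not pairs of elements of V are dropped.
   [complete] relies on this; for wheels it only matters when the rim is
   degenerate (length 1) or h, r are not distinct, and for sums it never does. *)
Definition mkgraph V (E : {set {set T}}) : graph :=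
  @Graph V (E :&: pairs V) (subsetIr E (pairs V)).

Definition adj (G : graph) : rel T := [rel x y | [set x; y] \in eset G].

Definition complete V : graph := mkgraph V [set: {set T}].

Definition wheel n (h : T) (r : 'I_n -> T) : graph :=
  mkgraph (h |: [set r i | i : 'I_n])
          ([set [set r i; r (ordS i)] | i : 'I_n] :|:
           [set [set h; r i] | i : 'I_n]).

Definition edge_sum (I : finType) (G : I -> graph) : graph :=
  mkgraph (\bigcup_i vset (G i))
          [set e : {set T} | odd #|[set i | e \in eset (G i)]|].

Definition proper_subgraph (H G : graph) : bool :=
  [&& vset H \subset vset G, eset H \subset eset G
    & (vset H != vset G) || (eset H != eset G)].

Definition colorable (G : graph) (n : nat) : bool :=
  [exists f : {ffun {x : T | x \in vset G} -> 'I_n},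
    [forall x, forall y, adj G (val x) (val y) ==> (f x != f y)]].

Lemma colorable_exists (G : graph) : exists n, colorable G n.
Proof.
exists #|{: {x : T | x \in vset G}}|; apply/existsP.
exists [ffun x => enum_rank x].
apply/forallP => x; apply/forallP => y; apply/implyP => xy.
rewrite !ffunE (inj_eq enum_rank_inj); apply/eqP => exy.
have := fintype.subsetP (eset_sub G) _ xy.
by rewrite exy inE finset.setUid cards1 andbF.
Qed.

Definition chromatic_number (G : graph) : nat := ex_minn (colorable_exists G).

Definition four_critical (G : graph) : Prop :=
  chromatic_number G = 4 /\
  forall H : graph, proper_subgraph H G -> chromatic_number H <= 3.

End Graphs.

Section Multiwheel.
Local Open Scope set_scope.
Variable q : nat.

Local Notation k := (q.*2.+1).

Definition mw_vertex : finType := option ('I_k + 'I_k).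

Definition mw_z : mw_vertex := None.
Definition mw_u (i : 'I_k) : mw_vertex := Some (inl i).
Definition mw_v (i : 'I_k) : mw_vertex := Some (inr i).

Definition mw_big_wheel : graph mw_vertex := wheel mw_z mw_u.

Definition mw_small_wheel (i : 'I_k) : graph mw_vertex :=
  complete [set mw_u i; mw_u (ordS i); mw_v i; mw_v (ordS i)].

Definition multiwheel : graph mw_vertex :=
  edge_sum (fun j : option 'I_k =>
    if j is Some i then mw_small_wheel i else mw_big_wheel).

End Multiwheel.

Local Open Scope classical_set_scope.
Local Open Scope ring_scope.
Local Open Scope quotient_scope.

Section ProjectivePlane.
Variable R : realType.

Definition nonzero_vector : topologicalType :=
  set_type [set v : 'rV[R]_3 | v != 0].

(* (a == b)%MS compares row spaces: the two vectors span the same line. *)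
Definition same_line (a b : nonzero_vector) : bool :=
  (set_val a == set_val b)%MS.

Lemma same_line_refl : reflexive same_line.
Proof. by move=> a; rewrite /same_line submx_refl. Qed.

Lemma same_line_sym : symmetric same_line.
Proof. by move=> a b; rewrite /same_line andbC. Qed.

Lemma same_line_trans : transitive same_line.
Proof.
move=> b a c /andP[ab ba] /andP[bc cb].
by rewrite /same_line (submx_trans ab bc) (submx_trans cb ba).
Qed.

Definition same_line_equiv : equiv_rel nonzero_vector :=
  EquivRel same_line same_line_refl same_line_sym same_line_trans.

Definition projective_plane : topologicalType :=
  quotient_topology {eq_quot same_line_equiv}.

End ProjectivePlane.

Section Embeddings.
Variables (R : realType) (T : finType) (X : topologicalType).

(* [arc e] is only relevant for edges e, on the unit interval; an edge is
   unordered, so its arc may run in either direction. *)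
Record embedding (G : graph T) (pt : T -> X) (arc : {set T} -> R -> X) : Prop :=
  Embedding {
  pt_inj : {in vset G &, injective pt};
  arc_continuous : forall e, e \in eset G -> {within `[0, 1], continuous (arc e)};
  arc_inj : forall e, e \in eset G -> {in `[0, 1] &, injective (arc e)};
  arc_ends : forall e, e \in eset G ->
    [set arc e 0; arc e 1] = pt @` [set` e];
  arc_pt : forall e x t, e \in eset G -> x \in vset G -> t \in `]0, 1[ ->
    arc e t <> pt x;
  arc_disjoint : forall e f s t, e \in eset G -> f \in eset G -> e != f ->
    s \in `]0, 1[ -> t \in `]0, 1[ -> arc e s <> arc f t
}.

Definition drawing (G : graph T) (pt : T -> X) (arc : {set T} -> R -> X) :
    set X :=
  pt @` [set` vset G] `|` \bigcup_(e in [set` eset G]) arc e @` `[0, 1].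

Definition cycle_curve (arc : {set T} -> R -> X) (c : seq T) : set X :=
  \bigcup_(x in [set` c]) arc [set x; next c x]%SET @` `[0, 1].

(* F is an open disk whose boundary is traced exactly once by the simple closed
   curve B.  The norm of R * R is the sup norm, so the unit ball is the square
   [-1, 1] x [-1, 1].  Equality of B with the frontier of F would be too weak:
   it also holds for the Moebius strip outside a contractible cycle of the
   projective plane, and for the complement of a noncontractible cycle, whose
   boundary walk traverses that cycle twice. *)
Definition disk_bounded_by (F B : set X) : Prop :=
  exists phi : R * R -> X,
    [/\ {within [set p | `|p| <= 1], continuous phi},
        {in [set p | `|p| <= 1] &, injective phi},
        phi @` [set p | `|p| < 1] = F
      & phi @` [set p | `|p| = 1] = B].

Definition quadrangulates (G : graph T) : Prop :=
  exists (pt : T -> X) (arc : {set T} -> R -> X),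
    embedding G pt arc /\
    forall x, ~ drawing G pt arc x ->
      exists c : seq T,
        [/\ size c = 4%N, ucycle (adj G) c
          & disk_bounded_by (connected_component (~` drawing G pt arc) x)
                            (cycle_curve arc c)].

End Embeddings.

Definition quadrangulates_projective_plane (R : realType) (T : finType)
    (G : graph T) : Prop :=
  quadrangulates R (projective_plane R) G.

(* Main.v *)
Require Import Defs.
From mathcomp Require Import all_boot all_order all_algebra.
From mathcomp Require Import all_classical all_reals all_analysis.
From mathcomp Require Import zify ring lra.

Set Implicit Arguments.
Unset Strict Implicit.
Unset Printing Implicit Defensive.
Import Order.TTheory GRing.Theory Num.Theory.
Import numFieldNormedType.Exports.

(** Why the multiwheel is 4-critical.  The parity count leaves the edges of
    Mycielski's construction on the odd cycle with [k] vertices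
    ([multiwheel_adj]).  Three colours do not suffice: recolouring every [v_i]
    that has the colour of [z] by the colour of [u_i] would 2-colour the odd
    cycle [v_0 v_1 ...] ([multiwheel_not_3colorable]).  If one edge is deleted,
    three colours suffice: the hub gets colour 2, every [u_i] with its spoke
    gets 0 or 1, and the failure of alternation along an odd cycle is absorbed by
    colour 2 next to the deleted edge ([multiwheel_edge_critical]).

    Why it quadrangulates the projective plane.  Points of the plane are lines
    of R^3, and every edge is drawn as a straight segment.  Let [U_i] be the unit
    vector of the plane at angle [i * (pi + pi / k)].  These vectors are
    [k]-periodic in [i]; going round the circle one meets alternately a [U_i]
    and an opposite [- U_j], and the neighbours of [U_i] are [- U_(i+1)] and
    [- U_(i-1)].  Place [z] at [(0, 1)], [u_i] at [(U_i, rho)] and [v_i] at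
    [(- U_i, 1)], with [rho > 1].  At positive height the vertices [u_i] and
    [v_i] form a closed polygon with [2k] sides around [z], whose sides are the
    edges between some [u_i] and some [v_j].  The opposite of [v_i] is
    [(U_i, - 1)], and [v_i v_(i+1)] is drawn from [(- U_i, 1)] to
    [(U_(i+1), - 1)], hence between that polygon and its opposite.

    All computations take place in the [k] sectors of vectors
    [(a U_i - b U_(i+1), h)] with [a] and [b] of the same weak sign.  Each sector
    consists of two opposite wedges, and opposite vectors span the same line; the
    sectors cover R^3 ([u_cover]) and overlap only on their sides ([u_sector]).
    In such coordinates the drawing is described by equations and inequalities in
    [a], [b], [h] that do not involve [i] ([drawn]), so that disjointness of arcs,
    and of faces from arcs, becomes real arithmetic.

    The faces are the quadrilaterals [u_i v_(i+1) u_(i+2) z] and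
    [v_i u_(i+1) v_(i+2) v_(i+1)].  The constant [rho] is such that each of them
    is convex in a projective sense: positive multiples [P_0], ..., [P_3] of its
    corners satisfy [P_0 + P_2 = P_1 + P_3].  Hence it is the image of a square
    under an injective linear map of R^3, which gives at once the parametrization
    by a disk, the boundary, and the fact that the interior is open while the
    interior with the boundary is closed ([quad_face]).  An open connected set
    with these properties that avoids the drawing is a component of the
    complement ([connected_component_clopen]), and the interiors cover the
    complement ([faces_cover]). *)

(** * The graph *)

Definition consec n (i j : 'I_n) : bool := (j == ordS i) || (i == ordS j).

Lemma ordS2_neq n (i : 'I_n) : 2 < n -> ordS (ordS i) != i.
Proof.
move=> n2; apply/eqP => /(congr1 val) /=; have := ltn_ord i.
case: (ltngtP i.+1 n) => // [lt|eq] _; last by rewrite eq modnn modn_small; lia.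
rewrite (modn_small lt); case: (ltngtP i.+2 n) => [lt2|?|eq2].
- by rewrite modn_small; lia.
- by lia.
- by rewrite eq2 modnn; lia.
Qed.

Lemma ordS_neq n (i : 'I_n) : 1 < n -> ordS i != i.
Proof.
move=> n2; apply/eqP => /(congr1 val) /=; have := ltn_ord i.
case: (ltngtP i.+1 n) => // [lt|eq] _; last by rewrite eq modnn; lia.
by rewrite (modn_small lt); lia.
Qed.

Section Multiwheel.
Variable q : nat.
Hypothesis q_gt0 : 0 < q.
Local Notation k := (q.*2.+1).
Local Notation M := (multiwheel q).
Implicit Types i j : 'I_k.

Let k_gt2 : 2 < k. Proof. by lia. Qed.
Let k_gt1 : 1 < k. Proof. by lia. Qed.

Definition mw_adj : rel (mw_vertex q) := fun x y =>
  match x, y with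
  | None, Some (inl _) | Some (inl _), None => true
  | Some (inl i), Some (inr j) | Some (inr i), Some (inl j)
  | Some (inr i), Some (inr j) => consec i j
  | _, _ => false
  end.

Definition mw_index (x : mw_vertex q) : option 'I_k :=
  match x with
  | Some (inl i) | Some (inr i) => Some i
  | None => None
  end.

Definition touches i (x : mw_vertex q) : bool :=
  if mw_index x is Some j then (j == i) || (j == ordS i) else false.

Lemma vset_small i : vset (mw_small_wheel i) = [set x | touches i x]%SET.
Proof.
apply/setP=> -[[j|j]|]; rewrite !inE //= /mw_u /mw_v /touches /=;
  by rewrite !(inj_eq Some_inj) /eq_op /= ?orbF.
Qed.

Lemma small_edge i x y : x != y ->
  ([set x; y]%SET \in eset (mw_small_wheel i)) = touches i x && touches i y.
Proof.
move=> xy; rewrite /mw_small_wheel /complete /= !inE cards2 xy andbT.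
have /= -> := vset_small i.
by rewrite finset.subUset !finset.sub1set !inE.
Qed.

Lemma set2_eq (T : finType) (x y a b : T) : x != y ->
  ([set x; y] == [set a; b])%SET = (x == a) && (y == b) || (x == b) && (y == a).
Proof.
move=> xy; apply/eqP/idP; last first.
  by case/orP => /andP[/eqP-> /eqP->] //; rewrite finset.setUC.
move=> /setP E; move: (E x) (E y); rewrite !inE !eqxx ?orbT /=.
by move: xy; do !case: eqP => //= ?; subst => //; rewrite ?eqxx.
Qed.

Lemma big_edge x y : x != y ->
  ([set x; y]%SET \in eset (mw_big_wheel q)) =
  match x, y with
  | None, Some (inl _) | Some (inl _), None => true
  | Some (inl i), Some (inl j) => consec i j
  | _, _ => false
  end.
Proof.
move=> xy; rewrite /mw_big_wheel /wheel /= !inE cards2 xy andbT.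
rewrite finset.subUset !finset.sub1set !inE.
have -> : ([set x; y]%SET \in [set [set mw_u i; mw_u (ordS i)]%SET | i : 'I_k]%SET)
   = if (x, y) is (Some (inl i), Some (inl j)) then consec i j else false.
  apply/imsetP/idP => [[i _ /eqP]|].
    by rewrite set2_eq // => /orP[] /andP[/eqP-> /eqP->]; rewrite /= /consec eqxx ?orbT.
  case: x y {xy} => [[i|i]|] [[j|j]|] //= /orP[] /eqP ->; first by exists i.
  by exists j; rewrite // finset.setUC.
have -> : ([set x; y]%SET \in [set [set mw_z q; mw_u i]%SET | i : 'I_k]%SET)
   = match x, y with None, Some (inl _) | Some (inl _), None => true | _, _ => false end.
  apply/imsetP/idP => [[i _ /eqP]|].
    by rewrite set2_eq // => /orP[] /andP[/eqP-> /eqP->].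
  case: x y {xy} => [[i|i]|] [[j|j]|] //= _; first by exists i; rewrite // finset.setUC.
  by exists j.
have im j : Some (inl j) \in [set mw_u i | i : 'I_k]%SET by apply: imset_f.
by case: x y xy => [[i|i]|] [[j|j]|] //=; rewrite ?im ?orbT ?orbF ?andbT ?andbF //= => _;
   case: consec.
Qed.

Lemma vset_multiwheel : vset M = [set: mw_vertex q]%SET.
Proof.
apply/setP => x; rewrite inE; apply/bigcupP.
case: x => [[i|i]|]; last by exists None; rewrite //= !inE eqxx.
  by exists (Some i); rewrite // vset_small inE /touches /= eqxx.
by exists (Some i); rewrite // vset_small inE /touches /= eqxx.
Qed.

(** The small wheels that contain a vertex of index [i] are those of index [i]
    and [i - 1].  So two vertices of indices [i] and [j] lie together in two
    small wheels if [i = j], in one if [i] and [j] are consecutive (here [k > 2]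
    is used) and in none otherwise.  The edges [u_i v_i] therefore vanish, and
    the edges [u_i u_(i+1)] vanish against the rim of the big wheel. *)
Lemma multiwheel_adj x y : adj M x y = mw_adj x y.
Proof.
have [<-|xy] := eqVneq x y.
  rewrite /adj /= !inE cards2 eqxx !andbF; case: x => [[i|i]|] //=.
  by rewrite /consec orbb eq_sym (negbTE (ordS_neq _ _)).
rewrite /adj /= -[\bigcup_i _]/(vset M) vset_multiwheel !inE cards2 xy finset.subsetT !andbT.
set A := finset _.
have -> : #|A| = ([set x; y]%SET \in eset (mw_big_wheel q))
               + #|[set i | touches i x && touches i y]%SET|.
  rewrite (cardsD1 None A) inE; congr (_ + _).
  rewrite -[RHS](card_imset _ (@Some_inj _)); apply: eq_card => -[i|]; last first.
    by rewrite !inE eqxx /=; apply/esym/imsetP => -[].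
  rewrite mem_imset; last exact: Some_inj.
  by rewrite [RHS]finset.in_set -small_edge // finset.in_setD1 [X in _ && X]finset.in_set.
rewrite big_edge // oddD.
have card2 x' y' i j : mw_index x' = Some i -> mw_index y' = Some j ->
   odd #|[set l | touches l x' && touches l y']%SET| = consec i j.
  have toE l t (a : 'I_k) : mw_index t = Some a ->
      touches l t = (l \in [set a; ord_pred a]%SET).
    rewrite /touches => ->; rewrite !inE eq_sym; congr (_ || _).
    by rewrite -(inj_eq (@ord_pred_inj k)) ordSK eq_sym.
  move=> x'i y'j.
  have -> : [set l | touches l x' && touches l y']%SET
     = ([set i; ord_pred i] :&: [set j; ord_pred j])%SET.
    by apply/setP => l; rewrite !finset.in_setI finset.in_set (toE _ _ i) ?(toE _ _ j).
  rewrite /consec.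
  have pn (a : 'I_k) : a != ord_pred a by rewrite -{1}(ord_predK a) ordS_neq.
  have [->|ji] := eqVneq j i.
    rewrite orbb eq_sym (negbTE (ordS_neq _ _)) //.
    by rewrite finset.setIid cards2 pn.
  have [->|jS] := eqVneq j (ordS i).
    rewrite ordSK (_ : _ :&: _ = [set i])%SET ?cards1 //.
    apply/setP => l; rewrite !inE; case: (eqVneq l i) => [->|_]; first by rewrite orbT.
    apply/negbTE/negP => /andP[/eqP -> ]; rewrite orbF => /eqP h.
    by have := ordS2_neq i k_gt2; rewrite -h ord_predK eqxx.
  have [iS|iS] := eqVneq i (ordS j).
    rewrite iS ordSK (_ : _ :&: _ = [set j])%SET ?cards1 ?orbT //.
    apply/setP => l; rewrite !inE; case: (eqVneq l j) => [->|_]; first by rewrite orbT.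
    apply/negbTE/negP => /andP[]; rewrite orbF => /eqP -> /eqP h.
    by have := ordS2_neq j k_gt2; rewrite h ord_predK eqxx.
  rewrite (_ : _ :&: _ = finset.set0)%SET ?cards0 //.
  apply/setP => l; rewrite !inE; apply/negP => /andP[] /orP[]/eqP -> /orP[]/eqP h.
  - by rewrite h eqxx in ji.
  - by rewrite h ord_predK eqxx in jS.
  - by rewrite -h ord_predK eqxx in iS.
  - by move/ord_pred_inj: h => h; rewrite h eqxx in ji.
have card0 (P : pred 'I_k) : (forall i, P i = false) -> odd #|[set i | P i]%SET| = false.
  by move=> P0; rewrite (_ : [set _ | _]%SET = finset.set0) ?cards0 //; apply/setP => l; rewrite !inE P0.
move: (card2 x y) (card0 (fun l => touches l x && touches l y)); clear.
case: x y => [[i|i]|] [[j|j]|] /= c2 c0; rewrite ?(c2 i j) ?oddb ?addbb //= ?c0 //;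
  by move=> l; rewrite ?andbF.
Qed.

(** * Criticality *)

Lemma colorable_nat (T : finType) (G : graph T) n (c : T -> nat) :
  (forall x, c x < n) -> (forall x y, adj G x y -> c x != c y) -> colorable G n.
Proof.
move=> cn cP; apply/existsP; exists [ffun x => Ordinal (cn (val x))].
apply/forallP => x; apply/forallP => y; apply/implyP => /cP.
by rewrite !ffunE.
Qed.

Lemma colorableW (T : finType) (G : graph T) m n :
  m <= n -> colorable G m -> colorable G n.
Proof.
move=> mn /existsP[f /forallP fP]; apply/existsP.
exists [ffun x => widen_ord mn (f x)].
apply/forallP => x; apply/forallP => y; apply/implyP => xy.
by have /forallP/(_ y)/implyP/(_ xy) := fP x; rewrite !ffunE.
Qed.

Lemma chromatic_le (T : finType) (G : graph T) n :
  colorable G n -> chromatic_number G <= n.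
Proof. by rewrite /chromatic_number; case: ex_minnP => m _ /(_ n). Qed.

Lemma chromatic_eq (T : finType) (G : graph T) n :
  colorable G n.+1 -> ~~ colorable G n -> chromatic_number G = n.+1.
Proof.
rewrite /chromatic_number; case: ex_minnP => m mc mP /mP le nc.
apply/eqP; rewrite eqn_leq le ltnNge; apply: contra nc => mn.
exact: colorableW mc.
Qed.

(** Otherwise [b] alternates along the cycle, and an odd number of changes would
    bring it back to its first value. *)
Lemma odd_cycle_not_bipartite (b : 'I_k -> bool) :
  exists i, b (ordS i) = b i.
Proof.
have [/existsP[i /eqP]|] := boolP [exists i, b (ordS i) == b i]; first by exists i.
rewrite negb_exists => /forallP nb; exfalso.
have alt n : n < k -> b (inord n) = b ord0 (+) odd n.
  elim: n => [|n IH] nk.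
    by rewrite addbF; congr b; apply: val_inj; rewrite /= inordK.
  have := nb (inord n); rewrite IH 1?ltnW //.
  have -> : ordS (inord n : 'I_k) = inord n.+1.
    apply: val_inj; rewrite /= (inordK nk) (_ : nat_of_ord (inord n) = n) ?modn_small //.
    by rewrite inordK // ltnW.
  by rewrite /=; case: (b _) (b _) (odd n) => -[] [].
have := nb ord_max; have -> : ordS (@ord_max q.*2) = ord0.
  by apply: val_inj; rewrite /= modnn.
by rewrite -(inord_val ord_max) alt //= odd_double addbF eqxx.
Qed.

(** The recoloured cycle [c'] avoids the colour of [z], so it has only two
    colours; it is proper because a recoloured [v_i] takes over the adjacencies
    of [u_i] to the vertices [v_(i-1)] and [v_(i+1)]. *)
Lemma multiwheel_not_3colorable : ~~ colorable M 3.
Proof.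
apply/negP => /existsP[f /forallP fP].
have inM x : x \in vset M by rewrite vset_multiwheel inE.
pose c x := f (exist _ x (inM x)).
have cP x y : mw_adj x y -> c x != c y.
  rewrite -multiwheel_adj => xy.
  exact: (implyP (forallP (fP (exist _ x (inM x))) (exist _ y (inM y))) xy).
pose z := mw_z q; pose u := @mw_u q; pose v := @mw_v q.
pose c' i := if c (v i) == c z then c (u i) else c (v i).
have c'z i : c' i != c z.
  by rewrite /c'; case: ifP => [_|/negbT //]; rewrite (cP (u i) z).
have c'S i : c' (ordS i) != c' i.
  have Sc : consec (ordS i) i by rewrite /consec eqxx orbT.
  have vv := cP (v (ordS i)) (v i) Sc; have uv := cP (u (ordS i)) (v i) Sc.
  have vu := cP (v (ordS i)) (u i) Sc.
  rewrite /c'; case: (eqVneq (c (v (ordS i))) (c z)) => [Sz|_]; last by case: ifP.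
  by case: ifP => // /eqP vz; rewrite Sz vz eqxx in vv.
have [i] := odd_cycle_not_bipartite (fun i => c' i == c' ord0).
move: (c'z (ordS i)) (c'z i) (c'z ord0) (c'S i).
move: (c' (ordS i)) (c' i) (c' ord0) (c z).
by do 4![case=> [[|[|[|//]]] ?]].
Qed.

(** As [u_i] is adjacent to the neighbours of [v_i] only, a 3-colouring of the
    cycle used for both [u] and [v] leaves the fourth colour to [z]. *)
Lemma multiwheel_4colorable : colorable M 4.
Proof.
pose t (j : 'I_k) : nat := if j == ord_max then 2 else odd j.
pose c (x : mw_vertex q) := if mw_index x is Some j then t j else 3.
apply: (@colorable_nat _ _ _ c) => [x|x y].
  by rewrite /c /t; case: mw_index => // j; case: ifP => // _; case: odd.
rewrite multiwheel_adj.
have tS j : t (ordS j) != t j.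
  rewrite /t -!val_eqE /=; have := ltn_ord j.
  move: (nat_of_ord j) => n nk; have [->|nm] := eqVneq n q.*2.
    by rewrite modnn (_ : (0 == q.*2) = false) //; lia.
  by rewrite modn_small; last lia; case: ifP => _ /=; case: (odd n).
have tP i j : consec i j -> t i != t j.
  by rewrite /consec => /orP[]/eqP->; rewrite // eq_sym.
have t3 j : t j != 3 by rewrite /t; case: ifP => // _; case: odd.
by case: x y => [[i|i]|] [[j|j]|] //=; rewrite /c /=; auto; rewrite eq_sym.
Qed.

Definition offset i j : nat := (j + (k - i)) %% k.

Lemma offset_lt i j : offset i j < k. Proof. by rewrite ltn_mod. Qed.

Lemma offset_eq0 i j : offset i j = 0 -> j = i.
Proof.
rewrite /offset => /eqP; have := ltn_ord i; have := ltn_ord j => jk ik.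
move=> /dvdnP[m mP]; apply: val_inj => /=.
by case: m mP => [|[|m]]; nia.
Qed.

Lemma offset_S i j : offset i (ordS j) = if offset i j == q.*2 then 0 else (offset i j).+1.
Proof.
have lt := offset_lt i j.
have -> : offset i (ordS j) = (offset i j).+1 %% k.
  by rewrite /offset /= modnDml addSn -[in RHS]addn1 modnDml addn1.
case: eqP => [->|ne]; first by rewrite modnn.
by rewrite modn_small; lia.
Qed.

(** For an edge at [u_i], put colour 2 on [z] and on [v_i] and alternate 1, 0 on
    the other [v_j], giving [u_j] the colour of [v_j].  Then [v_(i+1)] has colour
    1, [v_(i-1)] has colour 0, and [z] has colour 2: whichever of the three
    colours is given to [u_i], exactly one of its edges is violated.  For the
    edge between [v_(i-1)] and [v_i], give colour 2 to [z] and to both of its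
    ends, and alternate elsewhere. *)
Lemma multiwheel_edge_critical a b : mw_adj a b ->
  exists c : mw_vertex q -> nat, (forall x, c x < 3) /\
    forall x y, mw_adj x y -> c x = c y -> [set x; y]%SET = [set a; b]%SET.
Proof.
pose good a b := exists c : mw_vertex q -> nat, (forall x, c x < 3) /\
  forall x y, mw_adj x y -> c x = c y -> [set x; y]%SET = [set a; b]%SET.
have goodC x y : good x y -> good y x by rewrite /good finset.setUC.
have oriented (c : mw_vertex q -> nat) x y : (forall z, c z < 3) ->
  (forall j, c (mw_u j) = c (mw_z q) -> [set mw_u j; mw_z q]%SET = [set x; y]%SET) ->
  (forall j, c (mw_u j) = c (mw_v (ordS j)) -> [set mw_u j; mw_v (ordS j)]%SET = [set x; y]%SET) ->
  (forall j, c (mw_v j) = c (mw_u (ordS j)) -> [set mw_v j; mw_u (ordS j)]%SET = [set x; y]%SET) ->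
  (forall j, c (mw_v j) = c (mw_v (ordS j)) -> [set mw_v j; mw_v (ordS j)]%SET = [set x; y]%SET) ->
  good x y.
  move=> c3 uz uv vu vv; exists c; split=> // {}a {}b.
  case: a b => [[i|i]|] [[j|j]|] //=;
    rewrite -?/(mw_u _) -?/(mw_v _) -?/(mw_z q); try by [auto].
  - by move=> /orP[]/eqP-> e; [exact: uv | rewrite finset.setUC; apply: vu].
  - by move=> /orP[]/eqP-> e; [exact: vu | rewrite finset.setUC; apply: uv].
  - by move=> /orP[]/eqP-> e; [exact: vv | rewrite finset.setUC; apply: vv].
  - by move=> _ e; rewrite finset.setUC; apply: uz.
have par n : odd n = odd n.+1 :> nat -> False by rewrite /=; case: odd.
have odd2 n : odd n = 2 :> nat -> False by case: odd.
have q2 : (0 == q.*2) = false by lia.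
have q1 : 1 == q.*2 = false by lia.
(* [s] is the colour of [u_i]; the violated edge goes to [v_(i-1)], [v_(i+1)] or
   [z] according as it is 0, 1 or 2. *)
pose c0 i s (w : mw_vertex q) : nat := match w with
  | None => 2
  | Some (inl j) => if offset i j == 0 then s else nat_of_bool (odd (offset i j))
  | Some (inr j) => if offset i j == 0 then 2 else nat_of_bool (odd (offset i j))
  end.
have c0P i s x y : s < 3 ->
    (s = 2 -> [set mw_u i; mw_z q]%SET = [set x; y]%SET) ->
    (s = 1 -> [set mw_u i; mw_v (ordS i)]%SET = [set x; y]%SET) ->
    (s = 0 -> forall j, ordS j = i -> [set mw_v j; mw_u (ordS j)]%SET = [set x; y]%SET) ->
    good x y.
  move=> s3 s2 s1 s0; apply: (oriented (c0 i s)) => [w|j|j|j|j].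
  - by case: w => [[j|j]|] //=; case: ifP => // _; case: odd.
  - by rewrite /=; case: eqP => [/offset_eq0 ->|_ /odd2].
  - rewrite /= offset_S; case: eqP => [p0|_].
      by rewrite p0 q2 /= => h; rewrite (offset_eq0 p0); apply: s1.
    by case: (offset i j == q.*2) => [/odd2 //|/par].
  - rewrite /=; case: (eqVneq (offset i j) 0) => [p0|p0].
      by rewrite offset_S p0 q2.
    have [z|z] := eqVneq (offset i (ordS j)) 0.
      have /offset_eq0 Sj := z; move: z; rewrite offset_S; have [->|//] := eqVneq (offset i j) q.*2.
      by rewrite odd_double => _ h; apply: s0.
    by move: z; rewrite offset_S; case: (offset i j == q.*2) => // _ /par.
  - rewrite /=; case: (eqVneq (offset i j) 0) => [p0|p0].
      by rewrite offset_S p0 q2.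
    have [z /odd2 //|z] := eqVneq (offset i (ordS j)) 0.
    by move: z; rewrite offset_S; case: (offset i j == q.*2) => // _ /par.
pose c1 i (w : mw_vertex q) : nat := match w with
  | None => 2
  | Some (inl j) => odd (offset i j)
  | Some (inr j) => if (offset i j == 0) || (offset i j == q.*2) then 2 else nat_of_bool (odd (offset i j))
  end.
have c1P i x y :
    (forall j, ordS j = i -> [set mw_v j; mw_v (ordS j)]%SET = [set x; y]%SET) ->
    good x y.
  move=> iP; apply: (oriented (c1 i)) => [w|j|j|j|j].
  - by case: w => [[j|j]|] //=; [case: odd | case: ifP => // _; case: odd].
  - by rewrite /= => /odd2.
  - by rewrite /=; case: ifP => [_ /odd2 //|]; rewrite offset_S; case: ifP => //= _ _ /par.
  - by rewrite /=; case: ifP => [_ /esym/odd2 //|]; rewrite offset_S => /norP[_ /negbTE->] /par.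
  - rewrite /= offset_S; case: (eqVneq (offset i j) 0) => [->|p0] /=.
      by rewrite q2 /= q1.
    have [e|ne] := eqVneq (offset i j) q.*2.
      by move=> _; apply: iP; apply: offset_eq0; rewrite offset_S e eqxx.
    by rewrite /=; case: ifP => [_ /odd2 //|_ /par].
case: a b => [[i|i]|] [[j|j]|] //=; rewrite -?/(mw_u _) -?/(mw_v _) -?/(mw_z q) ?/consec.
- case/orP=> /eqP->; first by apply: (c0P i 1).
  by apply: goodC; apply: (c0P (ordS j) 0) => // _ l /ordS_inj ->.
- by move=> _; apply: (c0P i 2).
- case/orP=> /eqP->; last by apply: goodC; apply: (c0P j 1).
  by apply: (c0P (ordS i) 0) => // _ l /ordS_inj ->.
- by case/orP=> /eqP->; [|apply: goodC]; apply: c1P => l /ordS_inj ->.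
- by move=> _; apply: goodC; apply: (c0P j 2).
Qed.

Lemma mw_adj_witness x : exists y, mw_adj x y.
Proof.
case: x => [[i|i]|]; first by exists None.
  by exists (Some (inr (ordS i))); rewrite /= /consec eqxx.
by exists (Some (inl ord0)).
Qed.

(** Every vertex has an edge, so a proper subgraph always misses an edge. *)
Lemma multiwheel_four_critical : four_critical M.
Proof.
split; first exact: chromatic_eq multiwheel_4colorable multiwheel_not_3colorable.
move=> H /and3P[_ eHM neq]; apply: chromatic_le.
have [a [b [ab abH]]] : exists a b, mw_adj a b /\ [set a; b]%SET \notin eset H.
  case: (eqVneq (eset H) (eset M)) neq => [eHE|eHE _].
    rewrite orbF => vHE.
    have [x xH] : exists x, x \notin vset H.
      apply/existsP; rewrite -negb_forall; apply: contra vHE => /forallP vH.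
      by rewrite vset_multiwheel; apply/eqP/setP => x; rewrite vH inE.
    have [y xy] := mw_adj_witness x; exists x, y; split=> //.
    apply: contra xH => /(fintype.subsetP (eset_sub H)); rewrite inE => /andP[+ _].
    by rewrite finset.subUset finset.sub1set => /andP[].
  have /subsetPn[e eM eH] : ~~ (eset M \subset eset H).
    by apply: contra eHE => ?; rewrite finset.eqEsubset eHM.
  have := fintype.subsetP (eset_sub M) _ eM; rewrite inE => /andP[_ /cards2P[a [b [_ eE]]]].
  by exists a, b; rewrite -multiwheel_adj /adj /= -eE.
have [c [c3 cP]] := multiwheel_edge_critical ab.
apply: (colorable_nat c3) => x y xy; apply: contraNneq abH => cxy.
by rewrite -(cP x y) // -multiwheel_adj; apply: (fintype.subsetP eHM).
Qed.

End Multiwheel.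

Local Open Scope classical_set_scope.
Local Open Scope ring_scope.

(** * Segments and quadrilaterals in the projective plane *)

(** Relatively to the complement of [D], the set [F] is open, and also closed
    since [F `|` B] meets that complement in [F] only. *)
Lemma connected_component_clopen (X : topologicalType) (D F B : set X) x :
  open F -> closed (F `|` B) -> connected F -> F `<=` ~` D -> B `<=` D -> F x ->
  connected_component (~` D) x = F.
Proof.
move=> oF cFB cF FD BD Fx; apply/seteqP; split; last exact: connected_component_max.
set C := connected_component _ x; have CD : C `<=` ~` D by exact: connected_component_sub.
have FC : F `<=` C by exact: connected_component_max.
have CF : C `&` F = C.
  apply: (@component_connected _ (~` D) x (C `&` F)).
  - by exists x; split=> //; apply: FC.
  - by exists F.
  - exists (F `|` B) => //; apply/seteqP; split=> y [Cy]; first by split=> //; left.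
    by move=> [Fy|/BD Dy] //; case: (CD y Cy).
by rewrite -CF => y [].
Qed.

Section Projection.
Variable R : realType.
Local Notation V := 'rV[R]_3.
Implicit Types (v w A B : V) (a b c : R).

Lemma ones_neq0 : const_mx 1 != 0 :> V.
Proof.
apply/eqP => /matrixP/(_ 0 0); rewrite !mxE.
by move/eqP; rewrite oner_eq0.
Qed.

Definition nonzero v (v0 : v != 0) : nonzero_vector R :=
  exist (fun w : V => w \in [set w : V | w != 0]) v (mem_set v0).

(** Total in [v]: the zero vector is sent to an arbitrary line. *)
Definition line_of v : projective_plane R :=
  \pi_(projective_plane R)%qT (insubd (nonzero ones_neq0) v).

Lemma line_of_val (x : nonzero_vector R) : line_of (set_val x) = \pi_(projective_plane R)%qT x.
Proof. by rewrite /line_of valKd. Qed.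

Lemma nonzero_val v : v != 0 -> exists x : nonzero_vector R, set_val x = v.
Proof. by move=> v0; exists (nonzero v0). Qed.

Lemma nonzero_neq0 (x : nonzero_vector R) : set_val x != 0.
Proof. exact: (set_valP x). Qed.

Lemma line_of_surj (x : projective_plane R) : exists2 v, v != 0 & x = line_of v.
Proof.
exists (set_val (repr x)); first exact: nonzero_neq0.
by rewrite line_of_val reprK.
Qed.

Lemma line_of_eqP v w : v != 0 -> w != 0 ->
  line_of v = line_of w <-> exists2 c, c != 0 & v = c *: w.
Proof.
move=> v0 w0; have [x xv] := nonzero_val v0; have [y yw] := nonzero_val w0.
rewrite -xv -yw !line_of_val; split=> [/eqmodP /andP[/sub_rVP[c xc] _]|[c c0 xc]].
  exists c => //; apply: contra_neq v0 => c0.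
  by rewrite -xv xc c0 scale0r.
by apply/eqmodP; rewrite /= /same_line /= xc; apply/eqmxP; exact: eqmx_scale.
Qed.

Lemma line_of_scale c v : c != 0 -> line_of (c *: v) = line_of v.
Proof.
move=> c0; have [->|v0] := eqVneq v 0; first by rewrite scaler0.
by apply/line_of_eqP; [rewrite scaler_eq0 negb_or c0 | | exists c].
Qed.

Lemma line_ofN v : line_of (- v) = line_of v.
Proof. by rewrite -scaleN1r line_of_scale ?oppr_eq0 ?oner_eq0. Qed.

Lemma line_of_continuous (T : topologicalType) (f : T -> V) :
  continuous f -> (forall x, f x != 0) -> continuous (line_of \o f).
Proof.
move=> cf f0.
pose g x : nonzero_vector R := nonzero (f0 x).
have -> : line_of \o f = \pi_(projective_plane R)%qT \o g.
  by apply/funext => x; rewrite /= -line_of_val.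
move=> x; apply: continuous_comp; last exact: pi_continuous.
by move: x; apply/(@continuous_comp_initial _ _ _ set_val g).
Qed.

(** Since the topology is that of a quotient, an open (or closed) subset of the
    projective plane is best described by a set of vectors that is invariant
    under scaling; the condition [S v] then does not depend on the choice of
    [v] on its line ([cone_imageE]). *)
Definition cone_image (S : set V) : set (projective_plane R) :=
  line_of @` (S `&` [set v | v != 0]).

Definition scale_invariant (S : set V) := forall c v, c != 0 -> S v -> S (c *: v).

Lemma cone_imageE (S : set V) v : scale_invariant S -> v != 0 ->
  cone_image S (line_of v) <-> S v.
Proof.
move=> inv v0; split=> [[w [Sw w0] /line_of_eqP]|Sv]; last by exists v.
move=> /(_ w0 v0) [c c0 wc]; have -> : v = c^-1 *: w by rewrite wc scalerK.
by apply: inv; rewrite ?invr_eq0.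
Qed.

Lemma open_cone_image (S : set V) : scale_invariant S -> open S -> open (cone_image S).
Proof.
move=> inv oS.
rewrite /open /= /quotient_open.
rewrite (_ : _ @^-1` _ = set_val @^-1` S); first by exists S.
apply/seteqP; split=> x /=; rewrite -line_of_val => h.
  by apply/(cone_imageE inv _) => //; exact: nonzero_neq0.
by apply/(cone_imageE inv _) => //; exact: nonzero_neq0.
Qed.

Lemma closed_cone_image (S : set V) :
  scale_invariant S -> closed S -> closed (cone_image S).
Proof.
move=> inv cS.
have invC : scale_invariant (~` S).
  by move=> c v c0 nS Sc; apply: nS; rewrite -[v](scalerK c0); apply: inv; rewrite ?invr_eq0.
rewrite -[cone_image S]setCK; apply: open_closedC.
have -> : ~` cone_image S = cone_image (~` S); last first.
  by apply: open_cone_image; [exact: invC | rewrite openC].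
apply/seteqP; split=> x; have [v v0 ->] := line_of_surj x => h.
  by apply/(cone_imageE invC v0) => Sv; apply: h; apply/(cone_imageE inv v0).
by move/(cone_imageE inv v0); apply/(cone_imageE invC v0).
Qed.

(** The projective segment obtained from the combinations of [A] and [B] with
    nonnegative coefficients.  The vectors matter up to a common sign and
    positive factors only: replacing [B] by [- B] gives the complementary arc of
    the same projective line. *)
Definition segment A B : set (projective_plane R) :=
  [set x | exists a b, [/\ 0 <= a, 0 <= b, 0 < a + b & x = line_of (a *: A + b *: B)]].

End Projection.

Arguments line_of {R} v.

Section Segments.
Variable R : realType.
Local Notation V := 'rV[R]_3.
Implicit Types (A B u : V).

Lemma segmentC A B : segment A B = segment B A.
Proof.
apply/seteqP; split=> x [a [b [a0 b0 ab ->]]]; exists b, a;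
  by rewrite addrC (addrC (b *: _)).
Qed.

Lemma segment_centered A u : (forall s, A + s *: u != 0) ->
  segment (A - u) (A + u) = [set line_of (A + s *: u) | s in [set s : R | `|s| <= 1]].
Proof.
move=> nz; apply/seteqP; split=> x.
  move=> [a [b [a0 b0 ab ->]]]; exists ((b - a) / (a + b)).
    rewrite /= normrM normfV (gtr0_norm ab) ler_pdivrMr // mul1r ler_norml; lra.
  rewrite -(line_of_scale _ (lt0r_neq0 ab)); congr line_of.
  apply/rowP => i; rewrite !mxE; field; lra.
move=> [s /= s1 <-]; move: s1; rewrite ler_norml => /andP[s0 s1].
exists ((1 - s) / 2), ((1 + s) / 2); split; [lra|lra|lra|].
by congr line_of; apply/rowP => i; rewrite !mxE; field.
Qed.

Lemma segmentN A B : segment (- A) (- B) = segment A B.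
Proof.
apply/seteqP; split=> x [a [b [a0 b0 ab ->]]]; exists a, b; split=> //;
  by rewrite -[in RHS]line_ofN !scalerN opprD ?opprK.
Qed.

Lemma segment_scale A B c d : 0 < c -> 0 < d -> segment (c *: A) (d *: B) = segment A B.
Proof.
have sub (A' B' : V) (c' d' : R) : 0 < c' -> 0 < d' ->
    segment (c' *: A') (d' *: B') `<=` segment A' B'.
  move=> c0 d0 x [a [b [a0 b0 ab ->]]].
  exists (a * c'), (b * d'); rewrite !scalerA; split=> //; [nra|nra|].
  by case: (ltgtP a 0) a0 ab => // [a_gt0 _|->] ab; nra.
move=> c0 d0; apply/seteqP; split; first exact: sub.
rewrite -{1}[A](scalerK (lt0r_neq0 c0)) -{1}[B](scalerK (lt0r_neq0 d0)).
by apply: sub; rewrite invr_gt0.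
Qed.

Lemma segment_same_sign A B (a b : R) : 0 <= a * b -> a != 0 \/ b != 0 ->
  segment A B (line_of (a *: A + b *: B)).
Proof.
move=> ab ab0.
have [a0|a0] := lerP 0 a; have [b0|b0] := lerP 0 b.
- exists a, b; split=> //; rewrite lt0r addr_ge0 // andbT paddr_eq0 // negb_and.
  by apply/orP.
- by exists (- a), (- b); split; [nra|lra|nra|rewrite -line_ofN opprD !scaleNr].
- by exists (- a), (- b); split; [lra|nra|nra|rewrite -line_ofN opprD !scaleNr].
- by exists (- a), (- b); split; [lra|lra|lra|rewrite -line_ofN opprD !scaleNr].
Qed.

End Segments.

(** A quadrilateral whose corners are scaled so that the diagonals have the same
    midpoint [e0] is the image of the square [-1, 1] x [-1, 1] under
    [(s, t) |-> e0 + s e1 + t e2].  As [e0], [e1], [e2] are independent, lines of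
    R^3 get coordinates, up to scaling, in which the quadrilateral is given by
    [|y| <= |x|] and [|t| <= |x|]; these conditions ignore the sign of the vector. *)
Section Quadrilateral.
Variable R : realType.
Local Notation V := 'rV[R]_3.
Variables P0 P1 P2 P3 : V.
Hypothesis diagonals : P0 + P2 = P1 + P3.
Hypothesis P_free : forall a b c : R,
  a *: P0 + b *: P1 + c *: P3 = 0 -> [/\ a = 0, b = 0 & c = 0].

(* The corners are [e0 - e1 - e2], [e0 + e1 - e2], [e0 + e1 + e2] and [e0 - e1 + e2]. *)
Let e0 : V := 2^-1 *: (P1 + P3).
Let e1 : V := 2^-1 *: (P1 - P0).
Let e2 : V := 2^-1 *: (P3 - P0).

Let P0E : P0 = e0 - e1 - e2.
Proof. by apply/rowP => i; rewrite !mxE; field. Qed.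
Let P1E : P1 = e0 + e1 - e2.
Proof. by apply/rowP => i; rewrite !mxE; field. Qed.
Let P2E : P2 = e0 + e1 + e2.
Proof.
have -> : P2 = P1 + P3 - P0 by rewrite -diagonals addrC addKr.
by apply/rowP => i; rewrite !mxE; field.
Qed.
Let P3E : P3 = e0 - e1 + e2.
Proof. by apply/rowP => i; rewrite !mxE; field. Qed.

Let e_free x y t : x *: e0 + y *: e1 + t *: e2 = 0 -> [/\ x = 0, y = 0 & t = 0].
Proof.
move=> h; have [|h1 h2 h3] := @P_free (- (y + t) / 2) ((x + y) / 2) ((x + t) / 2).
  by rewrite -[RHS]h; apply/rowP => i; rewrite !mxE; field.
by split; lra.
Qed.

Let frame : 'M[R]_3 := \matrix_(i < 3) nth 0 [:: e0; e1; e2] i.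

Let mul_frame (x : V) : x *m frame = x 0 0 *: e0 + x 0 1 *: e1 + x 0 2 *: e2.
Proof.
rewrite mulmx_sum_row !big_ord_recl big_ord0 addr0 !rowK /= addrA.
by do !congr (_ + _ *: _); congr (x 0 _); apply: val_inj.
Qed.

Let frame_unit : frame \in unitmx.
Proof.
rewrite -row_free_unit; apply: inj_row_free => x; rewrite mul_frame => /e_free[x0 x1 x2].
apply/rowP => i; rewrite mxE; case: i => -[|[|[|//]]] p.
- by rewrite -x0; congr (x 0 _); apply: val_inj.
- by rewrite -x1; congr (x 0 _); apply: val_inj.
- by rewrite -x2; congr (x 0 _); apply: val_inj.
Qed.

Let coord (i : 'I_3) (v : V) : R := (v *m invmx frame) 0 i.

Let coordK v : v = coord 0 v *: e0 + coord 1 v *: e1 + coord 2 v *: e2.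
Proof. by rewrite -mul_frame mulmxKV. Qed.

Let coordE x y t : [/\ coord 0 (x *: e0 + y *: e1 + t *: e2) = x,
  coord 1 (x *: e0 + y *: e1 + t *: e2) = y & coord 2 (x *: e0 + y *: e1 + t *: e2) = t].
Proof.
set v := (_ + _).
have [|h0 h1 h2] := @e_free (x - coord 0 v) (y - coord 1 v) (t - coord 2 v); last by split; lra.
transitivity (v - (coord 0 v *: e0 + coord 1 v *: e1 + coord 2 v *: e2)).
  by rewrite {4}/v; apply/rowP => i; rewrite !mxE; ring.
by rewrite -coordK subrr.
Qed.

Let coordZ i c v : coord i (c *: v) = c * coord i v.
Proof. by rewrite /coord -scalemxAl mxE. Qed.

Let coord_cont i : continuous (coord i).
Proof.
have -> : coord i = fun v => \sum_j v 0 j * invmx frame j i.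
  by apply/funext => v; rewrite /coord mxE.
apply: continuous_big => [|j _ v]; first exact: add_continuous.
by apply: continuousM; [exact: coord_continuous | exact: cst_continuous].
Qed.

Let chart (p : R * R) : V := e0 + p.1 *: e1 + p.2 *: e2.

Let chart_neq0 p : chart p != 0.
Proof.
apply/eqP; rewrite /chart -[e0]scale1r => /e_free[/eqP].
by rewrite oner_eq0.
Qed.

Let chart_continuous : continuous chart.
Proof.
move=> p; apply: cvgD; first (apply: cvgD; first exact: cvg_cst).
  by apply: cvgZr_tmp; exact: cvg_fst.
by apply: cvgZr_tmp; exact: cvg_snd.
Qed.

Let open_square : set V := [set v | `|coord 1 v| < `|coord 0 v| /\ `|coord 2 v| < `|coord 0 v|].
Let closed_square : set V := [set v | `|coord 1 v| <= `|coord 0 v| /\ `|coord 2 v| <= `|coord 0 v|].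

Let norm_pair (p : R * R) : `|p| = Num.max `|p.1| `|p.2|.
Proof. by []. Qed.

Let coord_chart (p : R * R) : [/\ coord 0 (chart p) = 1, coord 1 (chart p) = p.1 & coord 2 (chart p) = p.2].
Proof. by rewrite /chart -{1 2 3}[e0]scale1r; exact: coordE. Qed.

Let chart_at (v : V) : coord 0 v != 0 -> v = coord 0 v *: chart (coord 1 v / coord 0 v, coord 2 v / coord 0 v).
Proof.
move=> v0; rewrite {1}[v]coordK /chart !scalerDr !scalerA /=.
by rewrite ![coord 0 v * _]mulrC !divfK.
Qed.

Let chart_open : (line_of \o chart) @` [set p | `|p| < 1] = cone_image open_square.
Proof.
apply/seteqP; split=> x.
  move=> [p /= p1 <-]; exists (chart p) => //; split; last exact: chart_neq0.
  have [h0 h1 h2] := coord_chart p; rewrite /open_square /= h0 h1 h2 normr1.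
  by move: p1; rewrite norm_pair gt_max => /andP[].
move=> [v [[v1 v2] _] <-].
have v0 : 0 < `|coord 0 v| by apply: le_lt_trans v1.
exists (coord 1 v / coord 0 v, coord 2 v / coord 0 v).
  by rewrite /= norm_pair gt_max !normrM !normfV /= !ltr_pdivrMr // !mul1r v1.
by rewrite [in RHS](chart_at (v := v)) -?normr_gt0 // line_of_scale // -normr_gt0.
Qed.

Let chart_closed : (line_of \o chart) @` [set p | `|p| <= 1] = cone_image closed_square.
Proof.
apply/seteqP; split=> x.
  move=> [p /= p1 <-]; exists (chart p) => //; split; last exact: chart_neq0.
  have [h0 h1 h2] := coord_chart p; rewrite /closed_square /= h0 h1 h2 normr1.
  by move: p1; rewrite norm_pair ge_max => /andP[].
move=> [v [[v1 v2] nz] <-].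
have v0 : 0 < `|coord 0 v|.
  rewrite normr_gt0; apply: contra_neq nz => v0; move: v1 v2.
  rewrite v0 normr0 !normr_le0 => /eqP v1 /eqP v2.
  by rewrite [v]coordK v0 v1 v2 !scale0r !addr0.
exists (coord 1 v / coord 0 v, coord 2 v / coord 0 v).
  by rewrite /= norm_pair ge_max !normrM !normfV /= !ler_pdivrMr // !mul1r v1.
by rewrite [in RHS](chart_at (v := v)) -?normr_gt0 // line_of_scale // -normr_gt0.
Qed.

Let open_interior : open ((line_of \o chart) @` [set p | `|p| < 1]).
Proof.
rewrite chart_open; apply: open_cone_image => [c v c0 [v1 v2]|].
  by rewrite /open_square /= !coordZ !normrM !ltr_pM2l ?normr_gt0.
have fabs i : continuous (fun v => `|coord i v|).
  by move=> v; apply: continuous_comp; [exact: coord_cont | exact: norm_continuous].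
have lt i : open [set v : V | `|coord i v| < `|coord 0 v|].
  have -> : [set v : V | `|coord i v| < `|coord 0 v|] =
      (fun v => `|coord 0 v| - `|coord i v|) @^-1` [set x | 0 < x].
    by apply/seteqP; split=> v /=; rewrite subr_gt0.
  apply: open_comp; last exact: open_gt.
  by move=> v _; exact: (continuousB (@fabs 0 v) (@fabs i v)).
by have := openI (lt 1) (lt 2).
Qed.

Let closed_closure : closed ((line_of \o chart) @` [set p | `|p| <= 1]).
Proof.
rewrite chart_closed; apply: closed_cone_image => [c v c0 [v1 v2]|].
  by rewrite /closed_square /= !coordZ !normrM !ler_pM2l ?normr_gt0.
have fabs i : continuous (fun v => `|coord i v|).
  by move=> v; apply: continuous_comp; [exact: coord_cont | exact: norm_continuous].
have le i : closed [set v : V | `|coord i v| <= `|coord 0 v|].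
  have -> : [set v : V | `|coord i v| <= `|coord 0 v|] =
      (fun v => `|coord 0 v| - `|coord i v|) @^-1` [set x | 0 <= x].
    by apply/seteqP; split=> v /=; rewrite subr_ge0.
  apply: (iffLR (continuous_closedP _) _ _ (@closed_ge _ 0)).
  by move=> v; exact: (continuousB (@fabs 0 v) (@fabs i v)).
by have := closedI (le 1) (le 2).
Qed.

Let line_of_chart_continuous : continuous (line_of \o chart).
Proof. exact: line_of_continuous. Qed.

(** The interior is star-shaped around the centre of the square. *)
Let connected_interior : connected ((line_of \o chart) @` [set p | `|p| < 1]).
Proof.
pose ray p : set (projective_plane R) := (fun t : R => line_of (chart (t *: p))) @` `[0, 1].
have -> : (line_of \o chart) @` [set p | `|p| < 1] = \bigcup_(p in [set p : R * R | `|p| < 1]) ray p.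
  apply/seteqP; split=> x.
    move=> [p /= p1 <-]; exists p => //; exists 1; first by rewrite /= in_itv /= ler01 lexx.
    by rewrite scale1r.
  move=> [p /= p1 [t /=]]; rewrite in_itv /= => /andP[t0 t1] <-; exists (t *: p) => //=.
  rewrite normrZ ger0_norm //; apply: le_lt_trans p1.
  by rewrite ler_piMl.
apply: bigcup_connected.
  exists (line_of (chart 0)) => p _; exists 0; first by rewrite /= in_itv /= ler01 lexx.
  by rewrite scale0r.
move=> p _; apply: connected_continuous_connected; first exact: segment_connected.
apply: continuous_subspaceT => t.
apply: (@continuous_comp _ _ _ (fun t : R => t *: p) (line_of \o chart)).
  by apply: cvgZr_tmp; exact: cvg_id.
exact: line_of_chart_continuous.
Qed.

Definition quad_boundary := segment P0 P1 `|` segment P1 P2 `|` segment P2 P3 `|` segment P3 P0.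

Let chart_boundary : (line_of \o chart) @` [set p | `|p| = 1] = quad_boundary.
Proof.
have nzE p : e0 + p.1 *: e1 + p.2 *: e2 != 0 := chart_neq0 p.
have s01 : segment P0 P1 = [set line_of (e0 - e2 + t *: e1) | t in [set t : R | `|t| <= 1]].
  have -> : P0 = e0 - e2 - e1 by rewrite P0E addrAC.
  have -> : P1 = e0 - e2 + e1 by rewrite P1E addrAC.
  apply: segment_centered => t; have := nzE (t, -1).
  by rewrite /= scaleN1r addrAC.
have s12 : segment P1 P2 = [set line_of (e0 + e1 + t *: e2) | t in [set t : R | `|t| <= 1]].
  rewrite P1E P2E.
  apply: segment_centered => t; have := nzE (1, t).
  by rewrite /= scale1r.
have s23 : segment P2 P3 = [set line_of (e0 + e2 + t *: e1) | t in [set t : R | `|t| <= 1]].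
  have -> : P3 = e0 + e2 - e1 by rewrite P3E addrAC.
  have -> : P2 = e0 + e2 + e1 by rewrite P2E addrAC.
  rewrite segmentC; apply: segment_centered => t; have := nzE (t, 1).
  by rewrite /= scale1r addrAC.
have s30 : segment P3 P0 = [set line_of (e0 - e1 + t *: e2) | t in [set t : R | `|t| <= 1]].
  rewrite P3E P0E segmentC.
  apply: segment_centered => t; have := nzE (-1, t).
  by rewrite /= scaleN1r.
rewrite /quad_boundary s01 s12 s23 s30; apply/seteqP; split=> x.
  move=> [[a b]]; rewrite /= norm_pair /chart /= => ab <-.
  have /andP[a1 b1] : (`|a| <= 1) && (`|b| <= 1) by rewrite -ge_max ab.
  have [aE|bE] : `|a| = 1 \/ `|b| = 1.
  - by move: ab; case: (leP `|a| `|b|); auto.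
  - move/eqP: aE; rewrite eqr_norml ler01 andbT => /orP[]/eqP ->.
      by left; left; right; exists b; rewrite // scale1r.
    by right; exists b; rewrite // scaleN1r.
  - move/eqP: bE; rewrite eqr_norml ler01 andbT => /orP[]/eqP ->.
      by left; right; exists a; rewrite // scale1r addrAC.
    by left; left; left; exists a; rewrite // scaleN1r addrAC.
move=> [[[]|]|] [t /= t1 <-].
- exists (t, -1); first by rewrite /= norm_pair /= normrN1; apply: max_r.
  by rewrite /chart /= scaleN1r addrAC.
- exists (1, t); first by rewrite /= norm_pair /= normr1; apply: max_l.
  by rewrite /chart /= scale1r.
- exists (t, 1); first by rewrite /= norm_pair /= normr1; apply: max_r.
  by rewrite /chart /= scale1r addrAC.
- exists (-1, t); first by rewrite /= norm_pair /= normrN1; apply: max_l.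
  by rewrite /chart /= scaleN1r.
Qed.

(** The open quadrilateral as its two open halves and the open diagonal between
    [P1] and [P3], the case [a = 0].  In the drawing each half lies in a single
    sector. *)
Definition quad_interior : set (projective_plane R) :=
  [set x | exists P a b c, [/\ P = P0 \/ P = P2, 0 <= a, 0 < b, 0 < c &
    x = line_of (a *: P + b *: P1 + c *: P3)]].

Let chart_interior : (line_of \o chart) @` [set p | `|p| < 1] = quad_interior.
Proof.
apply/seteqP; split=> x.
  move=> [[a b]]; rewrite /= norm_pair gt_max !ltr_norml /= => /andP[/andP[a0 a1] /andP[b0 b1]] <-.
  have [ab|ab] := lerP (a + b) 0.
    exists P0, (- (a + b) / 2), ((1 + a) / 2), ((1 + b) / 2); split; [by left|lra|lra|lra|].
    by congr line_of; rewrite /chart /=; apply/rowP => i; rewrite !mxE; field.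
  exists P2, ((a + b) / 2), ((1 - b) / 2), ((1 - a) / 2); split; [by right|lra|lra|lra|].
  by congr line_of; rewrite P2E /chart /=; apply/rowP => i; rewrite !mxE; field.
move=> [P [a [b [c [PE a0 b0 c0 ->]]]]]; rewrite chart_open.
have nrm (y s : R) : 0 < s -> - s < y < s -> `|y| < `|s|.
  by move=> s0; rewrite (gtr0_norm s0) ltr_norml.
case: PE => ->.
  have -> : a *: P0 + b *: P1 + c *: P3 =
      (a + b + c) *: e0 + (b - a - c) *: e1 + (c - a - b) *: e2.
    by apply/rowP => i; rewrite !mxE; field.
  have [h0 h1 h2] := coordE (a + b + c) (b - a - c) (c - a - b).
  eexists; last by []; split.
    by rewrite /open_square /= h0 h1 h2; split; apply: nrm; lra.
  by apply/eqP => /e_free[]; lra.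
have -> : a *: P2 + b *: P1 + c *: P3 =
    (a + b + c) *: e0 + (b + a - c) *: e1 + (c + a - b) *: e2.
  by rewrite P2E; apply/rowP => i; rewrite !mxE; field.
have [h0 h1 h2] := coordE (a + b + c) (b + a - c) (c + a - b).
eexists; last by []; split.
  by rewrite /open_square /= h0 h1 h2; split; apply: nrm; lra.
by apply/eqP => /e_free[]; lra.
Qed.

(** The chart itself is the required disk: its values at distinct points of the
    square are not proportional, because their coordinate along [e0] is 1. *)
Lemma quad_face (D : set (projective_plane R)) x :
  quad_interior `<=` ~` D -> quad_boundary `<=` D -> quad_interior x ->
  disk_bounded_by R (connected_component (~` D) x) quad_boundary.
Proof.
move=> ID BD Ix.
rewrite (@connected_component_clopen _ _ quad_interior quad_boundary) //.
- exists (line_of \o chart); split.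
  + by apply: continuous_subspaceT => p; exact: line_of_chart_continuous.
  + move=> p1 p2 _ _ /= /(line_of_eqP (chart_neq0 _) (chart_neq0 _))[c c0 E].
    have [h0 h1 h2] := coord_chart p1; have [g0 g1 g2] := coord_chart p2.
    have c1 : c = 1 by rewrite -h0 E coordZ g0 mulr1.
    move: E; rewrite c1 scale1r => E.
    by rewrite [p1]surjective_pairing -h1 -h2 E g1 g2 -surjective_pairing.
  + exact: chart_interior.
  + exact: chart_boundary.
- by rewrite -chart_interior.
- rewrite -chart_interior -chart_boundary -image_setU.
  rewrite (_ : _ `|` _ = [set p | `|p| <= 1]) //.
  apply/seteqP; split=> p /=; first by case=> [/ltW|->].
  by rewrite le_eqVlt => /orP[/eqP|]; auto.
- by rewrite -chart_interior.
Qed.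

End Quadrilateral.

Lemma cycle_curve4 (R : realType) (T : finType) (X : topologicalType) (arc : {set T} -> R -> X) x0 x1 x2 x3 :
  uniq [:: x0; x1; x2; x3] ->
  cycle_curve arc [:: x0; x1; x2; x3] =
    arc [set x0; x1]%SET @` `[0, 1] `|` arc [set x1; x2]%SET @` `[0, 1]
    `|` arc [set x2; x3]%SET @` `[0, 1] `|` arc [set x3; x0]%SET @` `[0, 1].
Proof.
rewrite /= !inE !negb_or !andbT => /andP[/and3P[n01 n02 n03] /andP[/andP[n12 n13] n23]].
have nx : [/\ next [:: x0; x1; x2; x3] x0 = x1, next [:: x0; x1; x2; x3] x1 = x2,
    next [:: x0; x1; x2; x3] x2 = x3 & next [:: x0; x1; x2; x3] x3 = x0].
  rewrite /= !eqxx; by rewrite ![x1 == _]eq_sym ![x2 == _]eq_sym ![x3 == _]eq_sym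
    !(negbTE n01, negbTE n02, negbTE n03, negbTE n12, negbTE n13, negbTE n23).
case: nx => e0 e1 e2 e3; apply/seteqP; split=> y.
  move=> [x xc]; have {xc} : x \in [:: x0; x1; x2; x3] by [].
  rewrite !inE => /or4P[]/eqP->; rewrite ?e0 ?e1 ?e2 ?e3 => hy.
  - by left; left; left.
  - by left; left; right.
  - by left; right.
  - by right.
case=> [[[|]|]|] hy.
- by exists x0; [rewrite /= !inE eqxx ?orbT | rewrite e0].
- by exists x1; [rewrite /= !inE eqxx ?orbT | rewrite e1].
- by exists x2; [rewrite /= !inE eqxx ?orbT | rewrite e2].
- by exists x3; [rewrite /= !inE eqxx ?orbT | rewrite e3].
Qed.

(** The hypotheses on the four arcs say that the sides of the quadrilateral are
    edges of the drawing, whatever the scaling of the corners. *)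
Lemma quad_face_cycle (R : realType) (T : finType) (G : graph T)
    (pt : T -> projective_plane R) (arc : {set T} -> R -> projective_plane R)
    (x0 x1 x2 x3 : T) (P0 P1 P2 P3 : 'rV[R]_3) (x : projective_plane R) :
  let D := drawing G pt arc in
  P0 + P2 = P1 + P3 ->
  (forall a b c, a *: P0 + b *: P1 + c *: P3 = 0 -> [/\ a = 0, b = 0 & c = 0]) ->
  ucycle (adj G) [:: x0; x1; x2; x3] ->
  arc [set x0; x1]%SET @` `[0, 1] = segment P0 P1 ->
  arc [set x1; x2]%SET @` `[0, 1] = segment P1 P2 ->
  arc [set x2; x3]%SET @` `[0, 1] = segment P2 P3 ->
  arc [set x3; x0]%SET @` `[0, 1] = segment P3 P0 ->
  quad_interior P0 P1 P2 P3 `<=` ~` D -> quad_interior P0 P1 P2 P3 x ->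
  exists c : seq T, [/\ size c = 4%N, ucycle (adj G) c
    & disk_bounded_by R (connected_component (~` D) x) (cycle_curve arc c)].
Proof.
move=> D dg fr cyc s01 s12 s23 s30 ID Ix.
have /andP[/= /and5P[a01 a12 a23 a30 _] un] := cyc.
have sub y z : adj G y z -> arc [set y; z]%SET @` `[0, 1] `<=` D.
  by move=> yz p hp; right; exists [set y; z]%SET; [exact: yz | exact: hp].
have curve := cycle_curve4 arc un.
have BD : cycle_curve arc [:: x0; x1; x2; x3] `<=` D.
  by rewrite curve; do 3?[rewrite subUset; split]; exact: sub.
have BE : cycle_curve arc [:: x0; x1; x2; x3] = quad_boundary P0 P1 P2 P3.
  by rewrite curve s01 s12 s23 s30.
exists [:: x0; x1; x2; x3]; split; [by []|exact: cyc|].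
by rewrite BE; apply: quad_face; [exact: dg|exact: fr|exact: ID|rewrite -BE|exact: Ix].
Qed.

(** * Directions in the plane *)

Section Directions.
Variables (R : realType) (q : nat).
Hypothesis q_gt0 : (0 < q)%N.
Local Notation k := (q.*2.+1).

Definition angle (n : nat) : R := n%:R * (pi / k%:R).

Let k_gt0 : 0 < k%:R :> R. Proof. by rewrite ltr0n. Qed.

Lemma angleS n : angle n.+1 = angle n + angle 1.
Proof. by rewrite /angle -natr1 mulrDl. Qed.

Lemma angle_k : angle k = pi.
Proof. by rewrite /angle mulrC divfK // lt0r_neq0. Qed.

Lemma angleD m n : angle (m + n) = angle m + angle n.
Proof. by rewrite /angle natrD mulrDl. Qed.

Definition wx n := cos (angle n).
Definition wy n := sin (angle n).

Lemma w_antipode n : wx (n + k) = - wx n /\ wy (n + k) = - wy n.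
Proof. by rewrite /wx /wy angleD angle_k cosDpi sinDpi. Qed.

Definition sin_angle n := sin (angle n).

Lemma sin_angle0 : sin_angle 0 = 0. Proof. by rewrite /sin_angle /angle mul0r sin0. Qed.

Lemma sin_angle_last : sin_angle q.*2 = sin_angle 1.
Proof.
have -> : sin_angle q.*2 = sin (pi - angle 1).
  by rewrite /sin_angle -angle_k angleS addrK.
by rewrite sinB sinpi cospi mul0r add0r mulN1r opprK.
Qed.

Lemma sin_angle_gt0 n : (0 < n < k)%N -> 0 < sin_angle n.
Proof.
move=> /andP[n0 nk]; apply: sin_gt0_pi.
have p0 : 0 < pi / k%:R :> R by rewrite divr_gt0 // pi_gt0.
rewrite /angle mulr_gt0 ?ltr0n //= -[ltRHS]angle_k /angle ltr_pM2r //.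
by rewrite ltr_nat.
Qed.

Lemma cross_w m n : (m <= n)%N -> wx m * wy n - wy m * wx n = sin_angle (n - m).
Proof.
move=> mn; have E : angle n = angle m + angle (n - m) by rewrite -angleD subnKC.
have -> : sin_angle (n - m) = sin (angle n - angle m) by rewrite E addrC addKr.
by rewrite sinB /wx /wy; ring.
Qed.

Definition two_cos : R := 2 * cos (angle 1).

Lemma two_cos_bounds : 0 < two_cos /\ two_cos < 2.
Proof.
have p0 := pi_gt0 R.
have k2 : 2 < k%:R :> R by rewrite ltr_nat; lia.
have a_gt0 : 0 < angle 1 by rewrite /angle mul1r divr_gt0.
have a_lt : angle 1 < pi / 2.
  by rewrite /angle mul1r ltr_pM2l // ltf_pV2 // posrE.
rewrite /two_cos; split.
  rewrite mulr_gt0 // cos_gt0_pihalf // a_lt andbT; lra.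
rewrite -[ltRHS]mulr1 ltr_pM2l // -[ltRHS]cos0.
rewrite ltr_cos ?in_itv /= ?lexx //; lra.
Qed.

Lemma w_rec n : wx n + wx n.+2 = two_cos * wx n.+1 /\ wy n + wy n.+2 = two_cos * wy n.+1.
Proof.
have E : angle n = angle n.+1 - angle 1 by rewrite angleS addrK.
rewrite /two_cos /wx /wy E (angleS n.+1) cosB cosD sinB sinD; split; ring.
Qed.

(** Two sectors between consecutive directions overlap only along a common side.
    If [m < n], the cross products of the equality with the directions [n] and
    [n.+1] give [sin] values that are nonnegative on the left, whereas they force
    [d <= 0] and [0 <= c] on the right; since [c] and [d] have the same sign, one
    of them vanishes. *)
Lemma w_sector m n a b c d : (m <= n < m + k)%N -> 0 <= a -> 0 <= b -> 0 <= c * d ->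
  a * wx m + b * wx m.+1 = c * wx n + d * wx n.+1 ->
  a * wy m + b * wy m.+1 = c * wy n + d * wy n.+1 ->
  [\/ [/\ n = m, c = a & d = b], [/\ n = m.+1, a = 0, d = 0 & c = b],
      [/\ n = (m + q.*2)%N, b = 0, c = 0 & d = - a]
    | [/\ a = 0, b = 0, c = 0 & d = 0]].
Proof.
move=> /andP[mn nk] a0 b0 cd Ex Ey.
have s1 : 0 < sin_angle 1 by apply: sin_angle_gt0; lia.
have cw i : wx i * wy i - wy i * wx i = 0 by ring.
have Cn : a * (wx m * wy n - wy m * wx n) + b * (wx m.+1 * wy n - wy m.+1 * wx n)
  = - d * (wx n * wy n.+1 - wy n * wx n.+1).
  transitivity ((a * wx m + b * wx m.+1) * wy n - (a * wy m + b * wy m.+1) * wx n).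
    by ring.
  by rewrite Ex Ey; ring.
have Cn1 : a * (wx m * wy n.+1 - wy m * wx n.+1) + b * (wx m.+1 * wy n.+1 - wy m.+1 * wx n.+1)
  = c * (wx n * wy n.+1 - wy n * wx n.+1).
  transitivity ((a * wx m + b * wx m.+1) * wy n.+1 - (a * wy m + b * wy m.+1) * wx n.+1).
    by ring.
  by rewrite Ex Ey; ring.
move: Cn Cn1; have [<-|nm] := eqVneq m n.
  rewrite !cw (cross_w (leqnSn m)) subSn // subnn.
  have -> : wx m.+1 * wy m - wy m.+1 * wx m = - sin_angle 1.
    have := @cross_w m m.+1 (leqnSn _); rewrite subSn // subnn => <-; ring.
  move=> h1 h2; constructor 1; split=> //; apply: (mulIf (lt0r_neq0 s1)); lra.
have mltn : (m < n)%N by rewrite ltn_neqAle nm.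
rewrite (cross_w mn) (cross_w mltn) (cross_w (leqnSn n)) (cross_w (leqW mn)) (@cross_w m.+1 n.+1) //.
rewrite (subSn mn) subSS subSnn.
have sp : 0 < sin_angle (n - m) by apply: sin_angle_gt0; lia.
have sp0 : 0 <= sin_angle (n - m.+1).
  have [->|/ltW//] : n = m.+1 \/ 0 < sin_angle (n - m.+1); last by rewrite subnn sin_angle0.
  by have [->|?] := eqVneq n m.+1; [left | right; apply: sin_angle_gt0; lia].
have sp2 : 0 <= sin_angle (n - m).+1.
  have [->|/ltW//] : (n - m).+1 = k \/ 0 < sin_angle (n - m).+1; last by rewrite /sin_angle angle_k sinpi.
  by have [->|?] := eqVneq (n - m).+1 k; [left | right; apply: sin_angle_gt0; lia].
move=> h1 h2.
have d0 : d <= 0 by nra.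
have c0 : 0 <= c by nra.
have [d00|d_neq0] := eqVneq d 0.
  have a00 : a = 0 by apply/eqP; rewrite eq_le a0 andbT; nra.
  have [b00|b_neq0] := eqVneq b 0.
    by constructor 4; split=> //; apply: (mulIf (lt0r_neq0 s1)); rewrite -h2 a00 b00; ring.
  have nm1 : n = m.+1.
    apply/eqP; apply: contraNT b_neq0 => nm1.
    have : 0 < sin_angle (n - m.+1) by apply: sin_angle_gt0; lia.
    by move=> ?; apply/eqP; apply/eqP; rewrite eq_le b0 andbT; nra.
  constructor 2; split=> //; apply: (mulIf (lt0r_neq0 s1)); rewrite -h2 a00 nm1.
  by rewrite subSn // subnn; ring.
have c00 : c = 0 by apply/eqP; rewrite eq_le c0 andbT; nra.
have b00 : b = 0 by apply/eqP; rewrite eq_le b0 andbT; nra.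
have [a00|a_neq0] := eqVneq a 0.
  constructor 4; split=> //; apply: (mulIf (lt0r_neq0 s1)); apply: oppr_inj.
  by rewrite -mulNr -h1 a00 b00; ring.
have nm1 : (n - m).+1 = k.
  apply/eqP; apply: contraNT a_neq0 => nm1.
  have : 0 < sin_angle (n - m).+1 by apply: sin_angle_gt0; lia.
  by move=> ?; apply/eqP; apply/eqP; rewrite eq_le a0 andbT; nra.
have nmq : (n - m)%N = q.*2 by lia.
constructor 3; split=> //; first by lia.
apply: (mulIf (lt0r_neq0 s1)); move: h1; rewrite b00 nmq sin_angle_last; lra.
Qed.

(** The cross product with the direction of index [n] changes sign between [n]
    and [n + k], hence between two consecutive indices. *)
Lemma sector_exists (x y : R) : exists n a b,
  [/\ 0 <= a * b, x = a * wx n + b * wx n.+1 & y = a * wy n + b * wy n.+1].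
Proof.
pose g n := wx n * y - wy n * x.
have gk n : g (n + k)%N = - g n.
  by rewrite /g; have [-> ->] := w_antipode n; ring.
have [n [g0 g1]] : exists n, 0 <= g n /\ g n.+1 <= 0.
  have up m : 0 <= g m -> exists n, 0 <= g n /\ g n.+1 <= 0.
    move=> gm; have [//|no] := pselect (exists n, 0 <= g n /\ g n.+1 <= 0).
    have pos l : 0 < g (m + l).+1.
      elim: l => [|l IH]; rewrite ltNge; apply/negP => le; apply: no.
        by exists (m + 0)%N; rewrite addn0 in le *.
      by exists (m + l).+1; rewrite (ltW IH) -addnS.
    by have := pos q.*2; rewrite -addnS gk; lra.
  have [/up//|lt] := lerP 0 (g 0%N).
  by apply: (up k); rewrite -[k]add0n gk; lra.
have s1 : 0 < sin_angle 1 by apply: sin_angle_gt0; lia.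
have cr := cross_w (leqnSn n); rewrite subSnn in cr.
exists n, (- g n.+1 / sin_angle 1), (g n / sin_angle 1); split.
- by rewrite mulrACA mulr_ge0 ?mulr_ge0 ?invr_ge0 ?(ltW s1) //; lra.
- have E : - g n.+1 * wx n + g n * wx n.+1 = x * sin_angle 1 by rewrite -cr /g; ring.
  by rewrite ![_ / _ * _]mulrAC -mulrDl E mulfK // lt0r_neq0.
- have E : - g n.+1 * wy n + g n * wy n.+1 = y * sin_angle 1 by rewrite -cr /g; ring.
  by rewrite ![_ / _ * _]mulrAC -mulrDl E mulfK // lt0r_neq0.
Qed.

(** The [U_n] of the drawing.  The sign compensates for the antipodality
    [w_antipode] since [k] is odd, so that [U_n] depends on [n] modulo [k] only;
    the neighbours of [U_n] on the circle become [- U_(n+1)] and [- U_(n-1)]. *)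
Definition ux_nat n := (-1) ^+ n * wx n.
Definition uy_nat n := (-1) ^+ n * wy n.

Lemma u_nat_period n : ux_nat (n + k) = ux_nat n /\ uy_nat (n + k) = uy_nat n.
Proof.
have [wxE wyE] := w_antipode n.
have sE : (-1) ^+ (n + k) = - (-1) ^+ n :> R.
  by rewrite exprD -[X in _ * X]signr_odd /= odd_double expr1 mulrN1.
by rewrite /ux_nat /uy_nat wxE wyE sE !mulrNN.
Qed.

Lemma u_nat_mod n : ux_nat (n %% k) = ux_nat n /\ uy_nat (n %% k) = uy_nat n.
Proof.
have H m r : ux_nat (r + m * k) = ux_nat r /\ uy_nat (r + m * k) = uy_nat r.
  elim: m => [|m [IHx IHy]]; first by rewrite mul0n addn0.
  rewrite mulSn (addnC k) addnA.
  by have [-> ->] := u_nat_period (r + m * k).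
have [] := H (n %/ k)%N (n %% k)%N.
by rewrite [(n %% k + _)%N]addnC -divn_eq.
Qed.

Lemma u_nat_modS n : ux_nat (n %% k).+1 = ux_nat n.+1 /\ uy_nat (n %% k).+1 = uy_nat n.+1.
Proof.
have e : ((n %% k).+1 = n.+1 %[mod k])%N by rewrite -(addn1 (n %% k)) modnDml addn1.
have [<- <-] := u_nat_mod (n %% k).+1; rewrite e; exact: u_nat_mod.
Qed.

Definition ux (i : 'I_k) := ux_nat i.
Definition uy (i : 'I_k) := uy_nat i.
Implicit Types i j : 'I_k.

Lemma u_ordS i : ux (ordS i) = ux_nat i.+1 /\ uy (ordS i) = uy_nat i.+1.
Proof. exact: u_nat_mod. Qed.

Lemma u_rec i : ux i + ux (ordS (ordS i)) = - (two_cos * ux (ordS i)) /\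
  uy i + uy (ordS (ordS i)) = - (two_cos * uy (ordS i)).
Proof.
have [-> ->] := u_ordS i.
have [-> ->] : ux (ordS (ordS i)) = ux_nat i.+2 /\ uy (ordS (ordS i)) = uy_nat i.+2.
  by have [-> ->] := u_ordS (ordS i); exact: u_nat_modS.
have [rx ry] := w_rec i.
rewrite /ux /uy /ux_nat /uy_nat !exprS !mulN1r opprK; split.
  by rewrite -mulrDr rx; ring.
by rewrite -mulrDr ry; ring.
Qed.

Lemma u_free i a b :
  a * ux i - b * ux (ordS i) = 0 -> a * uy i - b * uy (ordS i) = 0 -> a = 0 /\ b = 0.
Proof.
have [-> ->] := u_ordS i; rewrite /ux /uy /ux_nat /uy_nat exprS => Ex Ey.
have s1 : 0 < sin_angle 1 by apply: sin_angle_gt0; lia.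
have cr := cross_w (leqnSn i); rewrite subSnn in cr.
have e2 : (-1) ^+ i * (-1) ^+ i = 1 :> R by rewrite -exprMn mulrNN mulr1 expr1n.
set e := (-1) ^+ i in Ex Ey e2 *.
split; apply: (mulIf (lt0r_neq0 s1)); rewrite mul0r.
  transitivity (e * ((a * (e * wx i) - b * (-1 * e * wx i.+1)) * wy i.+1
     - (a * (e * wy i) - b * (-1 * e * wy i.+1)) * wx i.+1)).
    by rewrite -cr -[a]mul1r -[in LHS]e2; ring.
  by rewrite Ex Ey; ring.
transitivity (- e * ((a * (e * wx i) - b * (-1 * e * wx i.+1)) * wy i
   - (a * (e * wy i) - b * (-1 * e * wy i.+1)) * wx i)).
  by rewrite -cr -[b]mul1r -[in LHS]e2; ring.
by rewrite Ex Ey; ring.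
Qed.

Lemma u_cover (x y : R) : exists i a b,
  [/\ 0 <= a * b, x = a * ux i - b * ux (ordS i) & y = a * uy i - b * uy (ordS i)].
Proof.
have [n [a [b [ab xE yE]]]] := sector_exists x y.
pose i : 'I_k := Ordinal (ltn_pmod n (isT : (0 < k)%N)).
have [xS yS] := u_ordS i.
have xi : ux i = ux_nat n by have [] := u_nat_mod n.
have yi : uy i = uy_nat n by have [] := u_nat_mod n.
have [xs ys] : ux (ordS i) = ux_nat n.+1 /\ uy (ordS i) = uy_nat n.+1.
  by rewrite xS yS; exact: u_nat_modS.
have e2 : (-1) ^+ n * (-1) ^+ n = 1 :> R by rewrite -exprMn mulrNN mulr1 expr1n.
exists i, ((-1) ^+ n * a), ((-1) ^+ n * b); rewrite xi yi xs ys /ux_nat /uy_nat exprS.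
set e := (-1) ^+ n in e2 *; split.
- by rewrite mulrACA e2 mul1r.
- by rewrite xE -[LHS]mul1r -[in LHS]e2; ring.
- by rewrite yE -[LHS]mul1r -[in LHS]e2; ring.
Qed.

(** Besides the trivial case, equality occurs for one sector with itself, for
    adjacent sectors along their common side, and at the origin.  Both signs of
    [a] and [b] are allowed, so a sector stands here for itself and its opposite. *)
Lemma u_sector i j a b c d : 0 <= a * b -> 0 <= c * d ->
  a * ux i - b * ux (ordS i) = c * ux j - d * ux (ordS j) ->
  a * uy i - b * uy (ordS i) = c * uy j - d * uy (ordS j) ->
  [\/ [/\ j = i, c = a & d = b], [/\ j = ordS i, a = 0, d = 0 & c = - b],
      [/\ i = ordS j, b = 0, c = 0 & d = - a]
    | [/\ a = 0, b = 0, c = 0 & d = 0]].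
Proof.
wlog [a0 b0] : a b c d / 0 <= a /\ 0 <= b => [H|] ab cd Ex Ey.
  have [/H|] := pselect (0 <= a /\ 0 <= b); first exact.
  move=> neg; have [a0 b0] : a <= 0 /\ b <= 0.
    have [a0|a0] := lerP a 0; have [b0|b0] := lerP b 0; split=> //; nra.
  have [|||||[-> cE dE]|[-> aE dE cE]|[-> bE cE dE]|[aE bE cE dE]] :=
     H (- a) (- b) (- c) (- d).
  - by rewrite !oppr_ge0.
  - by rewrite mulrNN.
  - by rewrite mulrNN.
  - rewrite !mulNr -!opprD Ex; ring.
  - rewrite !mulNr -!opprD Ey; ring.
  - by constructor 1; split=> //; lra.
  - by constructor 2; split=> //; lra.
  - by constructor 3; split=> //; lra.
  - by constructor 4; split=> //; lra.
have [n [nj nk]] : exists n : nat, (n = j :> nat \/ n = j + k)%N /\ (i <= n < i + k)%N.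
  have := ltn_ord i; have := ltn_ord j; have [ij|ji] := leqP i j => jk ik.
    by exists j; split; [left | lia].
  by exists (j + k)%N; split; [right | lia].
have [jx jy jSx jSy] : [/\ ux j = ux_nat n, uy j = uy_nat n,
    ux (ordS j) = ux_nat n.+1 & uy (ordS j) = uy_nat n.+1].
  have [-> ->] := u_ordS j; case: nj => ->; first by split.
  have [p1 p2] := u_nat_period j; have [p3 p4] := u_nat_period j.+1.
  by rewrite -addSn p1 p2 p3 p4.
have {}nj : (j = n %% k :> nat)%N by case: nj => ->; rewrite ?modnDr modn_small.
have [iSx iSy] := u_ordS i.
pose s : R := (-1) ^+ i * (-1) ^+ n.
have s2 : s * s = 1 by rewrite /s mulrACA -!exprMn !mulrNN !mulr1 !expr1n mulr1.
have ei2 : (-1) ^+ i * (-1) ^+ i = 1 :> R by rewrite -exprMn mulrNN mulr1 expr1n.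
have w (z : nat -> R) l : (-1) ^+ l.+1 * z l.+1 = - ((-1) ^+ l * z l.+1) :> R.
  by rewrite exprS; ring.
have Ew (z : nat -> R) : a * ((-1) ^+ i * z i) - b * ((-1) ^+ i.+1 * z i.+1) =
     c * ((-1) ^+ n * z n) - d * ((-1) ^+ n.+1 * z n.+1) ->
   a * z i + b * z i.+1 = (s * c) * z n + (s * d) * z n.+1.
  rewrite !w => E; transitivity ((-1) ^+ i * (a * ((-1) ^+ i * z i) - b * - ((-1) ^+ i * z i.+1))).
    by rewrite -[LHS]mul1r -[in LHS]ei2; ring.
  by rewrite E /s; ring.
have [] := @w_sector i n a b (s * c) (s * d) nk a0 b0.
- by rewrite mulrACA s2 mul1r.
- by apply: Ew; rewrite -[LHS]/(a * ux i - b * ux_nat i.+1) -iSx Ex jx jSx.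
- by apply: Ew; rewrite -[LHS]/(a * uy i - b * uy_nat i.+1) -iSy Ey jy jSy.
- move=> [ni]; have -> : s = 1 by rewrite /s ni.
  rewrite !mul1r => -> ->; constructor 1; split=> //.
  by apply: val_inj; rewrite /= nj ni modn_small.
- move=> [ni -> sd sc]; have sE : s = -1 by rewrite /s ni exprS mulrCA ei2 mulr1.
  constructor 2; split=> //; [|by move: sd; rewrite sE; lra|by move: sc; rewrite sE; lra].
  by apply: val_inj; rewrite /= nj ni.
- move=> [ni -> sc sd]; have sE : s = 1.
    by rewrite /s ni exprD mulrA ei2 mul1r -signr_odd odd_double.
  constructor 3; split=> //; [|by move: sc; rewrite sE; lra|by move: sd; rewrite sE; lra].
  apply: val_inj; rewrite /= nj ni -(addn1 (_ %% k)) modnDml addn1 -addnS modnDr.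
  by rewrite modn_small.
- move=> [-> -> sc sd]; constructor 4; split=> //.
    by rewrite -[c]mul1r -s2 -mulrA sc mulr0.
  by rewrite -[d]mul1r -s2 -mulrA sd mulr0.
Qed.

End Directions.

(** * The drawing *)

Section Drawing.
Variables (R : realType) (q : nat).
Hypothesis q_gt0 : (0 < q)%N.
Local Notation k := (q.*2.+1).
Local Notation V := 'rV[R]_3.
Local Notation M := (multiwheel q).
Implicit Types (i j : 'I_k) (a b c d h s t : R).

Local Notation ux := (@ux R q).
Local Notation uy := (@uy R q).
Local Notation two_cos := (two_cos R q).

Let two_cos_gt0 : 0 < two_cos. Proof. by case: (two_cos_bounds R q_gt0). Qed.
Let two_cos_lt2 : two_cos < 2. Proof. by case: (two_cos_bounds R q_gt0). Qed.

(** With [c = two_cos], the hub faces are convex when [2 rho > c] and the rim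
    faces when [c rho > 2]; since [0 < c < 2], the value [3 / c] satisfies both. *)
Definition rho : R := 3 / two_cos.

Let rho_two_cos : rho * two_cos = 3. Proof. by rewrite /rho divfK // lt0r_neq0. Qed.
Let rho_gt0 : 0 < rho. Proof. by rewrite /rho divr_gt0. Qed.
Let rho_gt1 : 1 < rho.
Proof. by rewrite /rho ltr_pdivlMr // mul1r; apply: lt_trans two_cos_lt2 _; rewrite ltr_nat. Qed.

(** The vector [(a U_i - b U_(i+1), h)].  It is used with [0 <= a * b], and each
    line of R^3 contains such vectors. *)
Definition sector_vec i a b h : V :=
  \row_j [:: a * ux i - b * ux (ordS i); a * uy i - b * uy (ordS i); h]`_j.

Lemma sector_vec_scale c i a b h : c *: sector_vec i a b h = sector_vec i (c * a) (c * b) (c * h).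
Proof.
apply/rowP => l; rewrite !mxE; case: l => -[|[|[|//]]] ? //=; ring.
Qed.

Lemma sector_vec_add i a b h a' b' h' :
  sector_vec i a b h + sector_vec i a' b' h' = sector_vec i (a + a') (b + b') (h + h').
Proof.
apply/rowP => l; rewrite !mxE; case: l => -[|[|[|//]]] ? //=; ring.
Qed.

Lemma sector_vec_opp i a b h : - sector_vec i a b h = sector_vec i (- a) (- b) (- h).
Proof. by rewrite -scaleN1r sector_vec_scale !mulN1r. Qed.

(** The ray of [U_(i+1)] belongs to the sectors [i] and [i + 1], with opposite
    signs. *)
Lemma sector_vec_shift i b h : sector_vec i 0 b h = sector_vec (ordS i) (- b) 0 h.
Proof.
apply/rowP => l; rewrite !mxE; case: l => -[|[|[|//]]] ? //=; ring.
Qed.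

Lemma sector_vec_inj3 i a b h j a' b' h' : sector_vec i a b h = sector_vec j a' b' h' ->
  [/\ a * ux i - b * ux (ordS i) = a' * ux j - b' * ux (ordS j),
      a * uy i - b * uy (ordS i) = a' * uy j - b' * uy (ordS j) & h = h'].
Proof.
move/rowP => E; have := E 0; have := E 1; have := E 2.
by rewrite !mxE /=.
Qed.

Lemma sector_vec_free i a b h : sector_vec i a b h = 0 -> [/\ a = 0, b = 0 & h = 0].
Proof.
move=> E; have [|Ex Ey ->] := @sector_vec_inj3 i a b h i 0 0 0.
  by rewrite E; apply/rowP => l; rewrite !mxE; case: l => -[|[|[|//]]] ? /=; ring.
rewrite !mul0r subr0 in Ex Ey.
by have [-> ->] := u_free q_gt0 Ex Ey.
Qed.

Lemma sector_vec_cover (v : V) : exists i a b h, 0 <= a * b /\ v = sector_vec i a b h.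
Proof.
have [i [a [b [ab Ex Ey]]]] := @u_cover R q q_gt0 (v 0 0) (v 0 1).
exists i, a, b, (v 0 2); split=> //; apply/rowP => l; rewrite !mxE -Ex -Ey.
by case: l => -[|[|[|//]]] ? /=; congr (v 0 _); apply: val_inj.
Qed.

Lemma sector_vec_eq i j a b h a' b' h' : 0 <= a * b -> 0 <= a' * b' ->
  sector_vec i a b h = sector_vec j a' b' h' -> h' = h /\
  [\/ [/\ j = i, a' = a & b' = b], [/\ j = ordS i, a = 0, b' = 0 & a' = - b],
      [/\ i = ordS j, b = 0, a' = 0 & b' = - a]
    | [/\ a = 0, b = 0, a' = 0 & b' = 0]].
Proof. by move=> ab ab' /sector_vec_inj3[Ex Ey ->]; split=> //; exact: u_sector. Qed.

(** In order: the edges [u_i v_(i+1)], [v_i v_(i+1)] and [v_i u_(i+1)], then the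
    edges [z u_i] and [z u_(i+1)] on the two sides of the sector.  The last two
    conditions are multiplied by [a] or [b] so as to be insensitive to the sign
    of the vector, and they also hold for [z], where [a = b = 0]. *)
Definition drawn a b h : Prop :=
  [\/ h = rho * a + b, h = b - a | h = - a - rho * b] \/
  (b = 0 /\ rho * a ^+ 2 <= a * h) \/ (a = 0 /\ b * h <= - (rho * b ^+ 2)).

(** By [u_sector] only the common sides of adjacent sectors have to be compared. *)
Lemma drawn_sector_vec i j a b h a' b' h' : 0 <= a * b -> 0 <= a' * b' ->
  sector_vec i a b h = sector_vec j a' b' h' -> drawn a' b' h' -> drawn a b h.
Proof.
move=> ab ab' /(sector_vec_eq ab ab')[-> []].
- by case=> _ -> ->.
- case=> _ -> -> ->; rewrite /drawn !mulr0 !subr0 !addr0 !add0r.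
  case=> [[] hE|[[_ hE]|[/eqP + hE]]].
  + by left; constructor 3; rewrite hE; ring.
  + by left; constructor 1; rewrite hE; ring.
  + by left; constructor 1; rewrite hE; ring.
  + by right; right; split=> //; rewrite sqrrN mulNr in hE; lra.
  + by rewrite oppr_eq0 => /eqP->; right; right; split=> //; rewrite !mul0r expr0n mulr0; lra.
- case=> _ -> -> ->; rewrite /drawn !mulr0 !subr0 !addr0 !add0r.
  case=> [[] hE|[[/eqP + hE]|[_ hE]]].
  + by left; constructor 2; rewrite hE; ring.
  + by left; constructor 2; rewrite hE; ring.
  + by left; constructor 1; rewrite hE; ring.
  + by rewrite oppr_eq0 => /eqP->; right; left; split=> //; rewrite !mul0r expr0n mulr0; lra.
  + by right; left; split=> //; rewrite sqrrN mulNr in hE; lra.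
- by case=> -> -> -> ->.
Qed.

Lemma drawn_scale c a b h : drawn a b h -> drawn (c * a) (c * b) (c * h).
Proof.
have c2 : 0 <= c ^+ 2 by exact: sqr_ge0.
case=> [[] hE|[[-> hE]|[-> hE]]].
- by left; constructor 1; rewrite hE; ring.
- by left; constructor 2; rewrite hE; ring.
- by left; constructor 3; rewrite hE; ring.
- right; left; rewrite mulr0; split=> //.
  have := ler_wpM2l c2 hE.
  have -> : c ^+ 2 * (rho * a ^+ 2) = rho * (c * a) ^+ 2 by ring.
  by have -> : c ^+ 2 * (a * h) = c * a * (c * h) by ring.
- right; right; rewrite mulr0; split=> //.
  have := ler_wpM2l c2 hE.
  have -> : c ^+ 2 * - (rho * b ^+ 2) = - (rho * (c * b) ^+ 2) by ring.
  by have -> : c ^+ 2 * (b * h) = c * b * (c * h) by ring.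
Qed.

(** [Rise i] joins [u_i] to [v_(i+1)], [Fall i] joins [v_i] to [u_(i+1)] and
    [Rim i] joins [v_i] to [v_(i+1)]: each of them crosses sector [i] from side
    to side, while [Spoke i] lies on its first side. *)
Variant mw_edge := Spoke of 'I_k | Rise of 'I_k | Fall of 'I_k | Rim of 'I_k.
Implicit Types e f : mw_edge.

Definition mw_tail e : mw_vertex q :=
  match e with
  | Spoke i => mw_z q | Rise i => mw_u i | Fall i => mw_v i | Rim i => mw_v i
  end.

Definition mw_head e : mw_vertex q :=
  match e with
  | Spoke i => mw_u i | Rise i => mw_v (ordS i) | Fall i => mw_u (ordS i)
  | Rim i => mw_v (ordS i)
  end.

Definition ends e : {set mw_vertex q} := [set mw_tail e; mw_head e]%SET.

Lemma ends_neq e : mw_tail e != mw_head e.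
Proof.
case: e => i //=; apply/eqP => -[]/esym/eqP.
by rewrite (negbTE (ordS_neq _ _)) //; lia.
Qed.

Lemma ends_edge e : ends e \in eset M.
Proof.
have := @multiwheel_adj q q_gt0 (mw_tail e) (mw_head e); rewrite /adj /= => ->.
by case: e => i //=; rewrite /consec eqxx.
Qed.

Lemma edge_ends (E : {set mw_vertex q}) : E \in eset M -> exists e, ends e = E.
Proof.
move=> EM; have := fintype.subsetP (eset_sub M) _ EM; rewrite inE => /andP[_ /cards2P[x [y [_ EE]]]].
have : mw_adj x y by rewrite -multiwheel_adj // /adj /= -EE.
rewrite {}EE {EM E}; case: x y => [[i|i]|] [[j|j]|] //=; rewrite /consec.
- case/orP => /eqP->; first by exists (Rise i).
  by exists (Fall j); rewrite /ends finset.setUC.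
- by move=> _; exists (Spoke i); rewrite /ends finset.setUC.
- case/orP => /eqP->; first by exists (Fall i).
  by exists (Rise j); rewrite /ends finset.setUC.
- case/orP => /eqP->; first by exists (Rim i).
  by exists (Rim j); rewrite /ends finset.setUC.
- by move=> _; exists (Spoke j).
Qed.

Lemma ends_inj : injective ends.
Proof.
have no2 i j : j = ordS i -> i = ordS j -> False.
  by move=> -> /esym/eqP; rewrite (negbTE (ordS2_neq _ _)) //; lia.
move=> e f /eqP; rewrite /ends set2_eq ?ends_neq //.
case/orP => /andP[/eqP].
  by case: e => i; case: f => j; rewrite /= /mw_u /mw_v /mw_z => + /eqP; congruence.
case: e => i; case: f => j; rewrite /= /mw_u /mw_v /mw_z => + /eqP; try congruence.
- by move=> [ij] [/esym/(no2 _ _ ij)].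
- by move=> [ij] [/esym/(no2 _ _ ij)].
- by move=> [ij] [/esym/(no2 _ _ ij)].
Qed.

Definition edge_index e : 'I_k :=
  match e with Spoke i | Rise i | Fall i | Rim i => i end.

(** The sector coordinates of the point at time [t] of a straight arc.  [Rim i]
    ends at [(U_(i+1), - 1)], the opposite of the vector used for [v_(i+1)]. *)
Definition arc_coords e t : R * R * R :=
  match e with
  | Spoke i => (t, 0, 1 - t + t * rho)
  | Rise i => (1 - t, t, (1 - t) * rho + t)
  | Fall i => (- (1 - t), - t, 1 - t + t * rho)
  | Rim i => (- (1 - t), - t, 1 - t - t)
  end.

Definition arc_vec e t : V :=
  sector_vec (edge_index e) (arc_coords e t).1.1 (arc_coords e t).1.2 (arc_coords e t).2.

Definition vertex_vec (x : mw_vertex q) : V :=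
  match x with
  | None => sector_vec ord0 0 0 1
  | Some (inl i) => sector_vec i 1 0 rho
  | Some (inr i) => sector_vec i (- 1) 0 1
  end.

Definition vertex_pt x : projective_plane R := line_of (vertex_vec x).

Definition edge_arc e t : projective_plane R := line_of (arc_vec e t).

Lemma arc_vecE e t : arc_vec e t = (1 - t) *: arc_vec e 0 + t *: arc_vec e 1.
Proof.
by rewrite /arc_vec !sector_vec_scale sector_vec_add; case: e => i /=; congr sector_vec; ring.
Qed.

Lemma arc_vec_neq0 e t : arc_vec e t != 0.
Proof.
apply/eqP => /sector_vec_free[]; case: e => i /=;
  [move=> -> _; rewrite mul0r| | |]; by lra.
Qed.

Lemma arc_coords_same_sign e t : 0 <= t <= 1 -> 0 <= (arc_coords e t).1.1 * (arc_coords e t).1.2.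
Proof.
by move=> /andP[t0 t1]; case: e => i /=; rewrite ?mulr0 // ?mulrNN mulr_ge0 ?subr_ge0.
Qed.

Lemma arc_vec0 e : line_of (arc_vec e 0) = vertex_pt (mw_tail e).
Proof.
rewrite /vertex_pt /arc_vec; case: e => i /=; rewrite ?subr0 ?mul0r ?mul1r ?addr0 ?oppr0 //.
by congr line_of; apply/rowP => l; rewrite !mxE; case: l => -[|[|[|//]]] ? /=; ring.
Qed.

Lemma arc_vec1 e : line_of (arc_vec e 1) = vertex_pt (mw_head e).
Proof.
rewrite /vertex_pt /arc_vec; case: e => i /=;
  rewrite ?subrr ?mul0r ?mul1r ?add0r ?oppr0 ?sub0r // sector_vec_shift ?opprK //.
by rewrite -line_ofN sector_vec_opp opprK oppr0.
Qed.

Lemma vertex_vec_neq0 x : vertex_vec x != 0.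
Proof. by apply/eqP; case: x => [[i|i]|] /= /sector_vec_free[]; lra. Qed.

Lemma vertex_pt_inj : injective vertex_pt.
Proof.
move=> x y /(line_of_eqP (vertex_vec_neq0 x) (vertex_vec_neq0 y))[c c0].
have r0 := rho_gt0.
case: x => [[i|i]|]; case: y => [[j|j]|] //=; rewrite sector_vec_scale ?mulr0 => /sector_vec_eq[];
  rewrite ?mulr0 // => hE; case=> -[].
all: try by move=> ->.
all: by move=> *; exfalso; nra.
Qed.

Lemma edge_arc_pt e x t : 0 < t < 1 -> edge_arc e t <> vertex_pt x.
Proof.
move=> /andP[t0 t1] /(line_of_eqP (arc_vec_neq0 e t) (vertex_vec_neq0 x))[c c0].
have r1 := rho_gt1; have r0 := rho_gt0.
have ss : 0 <= (arc_coords e t).1.1 * (arc_coords e t).1.2 by apply: arc_coords_same_sign; lra.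
rewrite /arc_vec; case: x => [[j|j]|] /=; rewrite sector_vec_scale mulr0 => /(sector_vec_eq ss)[];
  rewrite ?mulr0 // => hE; case=> -[]; case: e ss hE => i /=; try lra.
- by move=> _ hE _ aE _; nra.
- by move=> _ hE _ aE _; nra.
Qed.

(** In the interior of an arc the coordinate [a] does not vanish, so the sectors
    agree; two different types of edge in one sector satisfy incompatible linear
    equations. *)
Lemma edge_arc_disjoint e f s t : 0 < s < 1 -> 0 < t < 1 -> edge_arc e s = edge_arc f t -> e = f.
Proof.
move=> /andP[s0 s1] /andP[t0 t1] /(line_of_eqP (arc_vec_neq0 e s) (arc_vec_neq0 f t))[c c0].
have r1 := rho_gt1; have r0 := rho_gt0.
have sse : 0 <= (arc_coords e s).1.1 * (arc_coords e s).1.2 by apply: arc_coords_same_sign; lra.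
have ssf : 0 <= (arc_coords f t).1.1 * (arc_coords f t).1.2 by apply: arc_coords_same_sign; lra.
rewrite /arc_vec sector_vec_scale => /(sector_vec_eq sse)[].
  by rewrite mulrACA mulr_ge0 // -expr2 sqr_ge0.
have a_neq0 g r : 0 < r -> r < 1 -> (arc_coords g r).1.1 <> 0 by case: g => i /=; lra.
move=> hE [[ij aE bE]|[_ /(a_neq0 _ _ s0 s1)]|[_ _ /eqP + _]|[/(a_neq0 _ _ s0 s1)]] //; last first.
  by rewrite mulf_eq0 (negbTE c0) => /eqP/(a_neq0 _ _ t0 t1).
move: hE aE bE.
have {}ij : edge_index f = edge_index e := ij.
case: e ij {sse} => i /=; case: f {ssf} => j /= -> //; rewrite ?mulr0 => hE aE bE; exfalso.
all: try (have aE' := congr1 ( *%R rho) aE; have bE' := congr1 ( *%R rho) bE).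
all: have rs := mulr_gt0 r0 s0; have rs' : 0 < rho * (1 - s) by rewrite mulr_gt0 // subr_gt0.
all: try lra.
all: by move/eqP: bE; rewrite ?mulrN ?oppr_eq0 mulf_eq0 (negbTE c0) /= => /eqP; lra.
Qed.

Lemma arc_vec_continuous e : continuous (arc_vec e).
Proof.
have -> : arc_vec e = fun t => (1 - t) *: arc_vec e 0 + t *: arc_vec e 1.
  by apply/funext => t; exact: arc_vecE.
move=> t; apply: cvgD.
  by apply: cvgZr_tmp; apply: cvgB; [exact: cvg_cst | exact: cvg_id].
by apply: cvgZr_tmp; exact: cvg_id.
Qed.

Lemma edge_arc_continuous e : continuous (edge_arc e).
Proof. exact: line_of_continuous (@arc_vec_continuous e) (@arc_vec_neq0 e). Qed.

Lemma edge_arc_inj e : injective (edge_arc e).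
Proof.
move=> s t /(line_of_eqP (arc_vec_neq0 e s) (arc_vec_neq0 e t))[c c0].
move=> /eqP; rewrite -subr_eq0 /arc_vec sector_vec_scale sector_vec_opp sector_vec_add => /eqP/sector_vec_free[].
have r0 := rho_gt0; case: e => i /= aE bE hE.
all: have sE : s = c * t by lra.
all: have c1 : c = 1 by rewrite sE in aE bE hE; lra.
all: by rewrite sE c1 mul1r.
Qed.

Definition u_vec i := sector_vec i 1 0 rho.
Definition v_vec i := sector_vec i (- 1) 0 1.
Definition z_vec := sector_vec ord0 0 0 1.

Lemma z_vecE i : z_vec = sector_vec i 0 0 1.
Proof. by apply/rowP => l; rewrite !mxE; case: l => -[|[|[|//]]] ? /=; ring. Qed.

Lemma u_vec_shift i : u_vec (ordS i) = sector_vec i 0 (- 1) rho.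
Proof. by rewrite sector_vec_shift opprK. Qed.

Lemma v_vec_shift i : v_vec (ordS i) = sector_vec i 0 1 1.
Proof. by rewrite sector_vec_shift. Qed.

Lemma edge_image e : edge_arc e @` `[0, 1] = segment (arc_vec e 0) (arc_vec e 1).
Proof.
apply/seteqP; split=> x.
  move=> [t /=]; rewrite in_itv /= => /andP[t0 t1] <-.
  exists (1 - t), t; split; [lra|by []|lra|].
  by rewrite /edge_arc [in LHS]arc_vecE.
move=> [a [b [a0 b0 ab ->]]]; exists (b / (a + b)).
  by rewrite /= in_itv /= ler_pdivrMr // mul1r lerDr a0 andbT divr_ge0 // ltW.
have ab0 : a + b != 0 by rewrite lt0r_neq0.
rewrite /edge_arc -(line_of_scale _ ab0) (arc_vecE e (b / (a + b))) scalerDr !scalerA.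
have -> : (a + b) * (1 - b / (a + b)) = a by field.
by have -> : (a + b) * (b / (a + b)) = b by field.
Qed.

Lemma image_spoke i : edge_arc (Spoke i) @` `[0, 1] = segment z_vec (u_vec i).
Proof.
rewrite edge_image (z_vecE i) /arc_vec /=.
by rewrite subr0 subrr mul0r mul1r add0r addr0.
Qed.

Lemma image_rise i : edge_arc (Rise i) @` `[0, 1] = segment (u_vec i) (v_vec (ordS i)).
Proof. by rewrite edge_image v_vec_shift /arc_vec /= subr0 subrr mul0r mul1r add0r addr0. Qed.

Lemma image_fall i : edge_arc (Fall i) @` `[0, 1] = segment (v_vec i) (u_vec (ordS i)).
Proof.
by rewrite edge_image u_vec_shift /arc_vec /= subr0 subrr mul0r mul1r add0r addr0 oppr0.
Qed.

Lemma image_rim i : edge_arc (Rim i) @` `[0, 1] = segment (v_vec i) (- v_vec (ordS i)).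
Proof.
by rewrite edge_image v_vec_shift sector_vec_opp /arc_vec /= !subr0 subrr sub0r oppr0.
Qed.

(** [ends] is injective, so the edge chosen here is the only possible one. *)
Definition arc_of (E : {set mw_vertex q}) : R -> projective_plane R :=
  if pselect (exists e, ends e = E) is left h then edge_arc (projT1 (cid h))
  else fun=> vertex_pt None.

Lemma arc_of_ends e : arc_of (ends e) = edge_arc e.
Proof.
rewrite /arc_of; case: pselect => [h|[]]; last by exists e.
by case: (cid h) => f /= /ends_inj ->.
Qed.

Lemma multiwheel_embedding : embedding M vertex_pt arc_of.
Proof.
split.
- by move=> x y _ _; exact: vertex_pt_inj.
- move=> E /edge_ends[e <-]; rewrite arc_of_ends.
  by apply: continuous_subspaceT => t; exact: edge_arc_continuous.
- by move=> E /edge_ends[e <-] s t _ _; rewrite arc_of_ends => /edge_arc_inj.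
- move=> E /edge_ends[e <-]; rewrite arc_of_ends /edge_arc arc_vec0 arc_vec1.
  apply/seteqP; split=> x.
    by case=> ->; [exists (mw_tail e)|exists (mw_head e)]; rewrite // /mkset /= !inE eqxx ?orbT.
  by move=> [y /=]; rewrite !inE => /orP[]/eqP-> <-; [left|right].
- move=> E x t /edge_ends[e <-] _; rewrite in_itv /= arc_of_ends.
  exact: edge_arc_pt.
- move=> E F s t /edge_ends[e <-] /edge_ends[f <-] ef; rewrite !in_itv /= !arc_of_ends.
  by move=> s01 t01 /(edge_arc_disjoint s01 t01) E'; rewrite E' eqxx in ef.
Qed.

Local Notation D := (drawing M vertex_pt arc_of).

Lemma edge_in_drawing e : edge_arc e @` `[0, 1] `<=` D.
Proof.
move=> x ex; right; exists (ends e); first exact: ends_edge.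
by rewrite arc_of_ends.
Qed.

Lemma drawing_drawn x : D x -> exists i a b h,
  [/\ 0 <= a * b, sector_vec i a b h != 0, drawn a b h & x = line_of (sector_vec i a b h)].
Proof.
have r1 := rho_gt1.
case=> [[w _ <-]|[E /edge_ends[e <-]]].
  rewrite /vertex_pt; have := vertex_vec_neq0 w; case: w => [[i|i]|] /= nz.
  - by exists i, 1, 0, rho; rewrite mulr0; split=> //; left; constructor 1; ring.
  - by exists i, (- 1), 0, 1; rewrite mulr0; split=> //; left; constructor 2; ring.
  - exists ord0, 0, 0, 1; rewrite mulr0; split=> //; right; left; split=> //.
    by rewrite expr0n mulr0 mul0r.
rewrite arc_of_ends => -[t /=]; rewrite in_itv /= => t01 <-.
exists (edge_index e), (arc_coords e t).1.1, (arc_coords e t).1.2, (arc_coords e t).2.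
split; [exact: arc_coords_same_sign|exact: arc_vec_neq0| |by []].
move/andP: t01 => [t0 t1].
case: e => i /=.
- by right; left; split=> //; nra.
- by left; constructor 1; ring.
- by left; constructor 3; ring.
- by left; constructor 2; ring.
Qed.

Lemma drawn_drawing i a b h : 0 <= a * b -> sector_vec i a b h != 0 -> drawn a b h ->
  D (line_of (sector_vec i a b h)).
Proof.
move=> ab nz; have r1 := rho_gt1.
have ab0 : ((a != 0) || (b != 0)) || (h != 0).
  apply: contraNT nz; rewrite !negb_or !negbK => /andP[/andP[/eqP-> /eqP->] /eqP->].
  by apply/eqP/rowP => l; rewrite !mxE; case: l => -[|[|[|//]]] ? /=; ring.
case=> [[] hE|[[b0 hE]|[a0 hE]]].
- apply: (@edge_in_drawing (Rise i)); rewrite image_rise v_vec_shift.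
  have -> : sector_vec i a b h = a *: u_vec i + b *: sector_vec i 0 1 1.
    by rewrite !sector_vec_scale sector_vec_add hE; congr sector_vec; ring.
  apply: segment_same_sign => //; apply/orP; move: ab0; rewrite hE.
  have [->|//] := eqVneq a 0; have [->|//] := eqVneq b 0.
  by rewrite ?mulr0 ?oppr0 ?subr0 ?addr0 eqxx.
- apply: (@edge_in_drawing (Rim i)); rewrite image_rim v_vec_shift sector_vec_opp.
  have -> : sector_vec i a b h = (- a) *: v_vec i + (- b) *: sector_vec i (- 0) (- 1) (- 1).
    by rewrite !sector_vec_scale sector_vec_add hE; congr sector_vec; ring.
  apply: segment_same_sign; rewrite ?mulrNN // !oppr_eq0; apply/orP; move: ab0; rewrite hE.
  have [->|//] := eqVneq a 0; have [->|//] := eqVneq b 0.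
  by rewrite ?mulr0 ?oppr0 ?subr0 ?addr0 eqxx.
- apply: (@edge_in_drawing (Fall i)); rewrite image_fall u_vec_shift.
  have -> : sector_vec i a b h = (- a) *: v_vec i + (- b) *: sector_vec i 0 (- 1) rho.
    by rewrite !sector_vec_scale sector_vec_add hE; congr sector_vec; ring.
  apply: segment_same_sign; rewrite ?mulrNN // !oppr_eq0; apply/orP; move: ab0; rewrite hE.
  have [->|//] := eqVneq a 0; have [->|//] := eqVneq b 0.
  by rewrite ?mulr0 ?oppr0 ?subr0 ?addr0 eqxx.
- apply: (@edge_in_drawing (Spoke i)); rewrite image_spoke (z_vecE i).
  have -> : sector_vec i a b h = (h - rho * a) *: sector_vec i 0 0 1 + a *: u_vec i.
    by rewrite !sector_vec_scale sector_vec_add b0; congr sector_vec; ring.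
  apply: segment_same_sign; first by nra.
  apply/orP; move: ab0; rewrite b0 eqxx /= orbF.
  by have [->|_ _] := eqVneq a 0; rewrite ?orbT //= mulr0 subr0 orbF.
- apply: (@edge_in_drawing (Spoke (ordS i))); rewrite image_spoke (z_vecE i) u_vec_shift.
  have -> : sector_vec i a b h = (h + rho * b) *: sector_vec i 0 0 1 + (- b) *: sector_vec i 0 (- 1) rho.
    by rewrite !sector_vec_scale sector_vec_add a0; congr sector_vec; ring.
  apply: segment_same_sign; first by nra.
  apply/orP; rewrite oppr_eq0; move: ab0; rewrite a0 eqxx /=.
  by have [->|_ _] := eqVneq b 0; rewrite ?orbT //= mulr0 addr0 orbF.
Qed.

Lemma not_in_drawing i a b h : 0 <= a * b -> sector_vec i a b h != 0 -> ~ drawn a b h ->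
  ~ D (line_of (sector_vec i a b h)).
Proof.
move=> ab nz nd /drawing_drawn[j [a' [b' [h' [ab' nz' dr /(line_of_eqP nz nz')[c c0]]]]]].
rewrite sector_vec_scale => E; apply: nd; apply: (drawn_sector_vec ab _ E); last exact: drawn_scale.
by rewrite mulrACA mulr_ge0 // -expr2 sqr_ge0.
Qed.

Lemma arc_tail_head e : arc_of [set mw_tail e; mw_head e]%SET @` `[0, 1] = edge_arc e @` `[0, 1].
Proof. by rewrite -[[set _; _]%SET]/(ends e) arc_of_ends. Qed.

Lemma arc_head_tail e : arc_of [set mw_head e; mw_tail e]%SET @` `[0, 1] = edge_arc e @` `[0, 1].
Proof. by rewrite finset.setUC arc_tail_head. Qed.

(** The face around [z] between the spokes of [u_i] and [u_(i+2)].  The weights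
    come from [U_i + U_(i+2) = - c U_(i+1)]. *)
Definition hub_face i := quad_interior (u_vec i) (two_cos *: v_vec (ordS i)) (u_vec (ordS (ordS i))) ((2 * rho - two_cos) *: z_vec).

Lemma hub_diagonals i : u_vec i + u_vec (ordS (ordS i)) = two_cos *: v_vec (ordS i) + (2 * rho - two_cos) *: z_vec.
Proof.
have [rx ry] := u_rec R i.
apply/rowP => l; rewrite !mxE; case: l => -[|[|[|//]]] ? /=; rewrite ?mul1r ?mul0r ?subr0.
- by rewrite rx; ring.
- by rewrite ry; ring.
- by ring.
Qed.

Let hub_weight_gt0 : 0 < 2 * rho - two_cos.
Proof. have r1 := rho_gt1; have c2 := two_cos_lt2; lra. Qed.

(** The half of the face next to [u_i] is the part of sector [i] above the edge
    [u_i v_(i+1)]; the other half lies in the opposite of sector [i + 1]. *)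
Lemma hub_interior i x : hub_face i x <->
  (exists a b h, [/\ 0 <= a, 0 < b, rho * a + b < h & x = line_of (sector_vec i a b h)]) \/
  (exists a b h, [/\ 0 <= a, 0 < b, rho * a + b < h & x = line_of (sector_vec (ordS i) (- b) (- a) h)]).
Proof.
have c0 := two_cos_gt0; have r1 := rho_gt1; have h0 := hub_weight_gt0.
have E1 a b c : a *: u_vec i + b *: (two_cos *: v_vec (ordS i)) + c *: ((2 * rho - two_cos) *: z_vec) =
    sector_vec i a (b * two_cos) (rho * a + b * two_cos + c * (2 * rho - two_cos)).
  by rewrite (z_vecE i) v_vec_shift !sector_vec_scale !sector_vec_add; congr sector_vec; ring.
have E2 a b c : a *: u_vec (ordS (ordS i)) + b *: (two_cos *: v_vec (ordS i)) + c *: ((2 * rho - two_cos) *: z_vec) =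
    sector_vec (ordS i) (- (b * two_cos)) (- a) (rho * a + b * two_cos + c * (2 * rho - two_cos)).
  by rewrite (z_vecE (ordS i)) (u_vec_shift (ordS i)) !sector_vec_scale !sector_vec_add; congr sector_vec; ring.
split.
  move=> [P [a [b [c [[]-> a0 b0 cpos ->]]]]]; [left|right].
    exists a, (b * two_cos), (rho * a + b * two_cos + c * (2 * rho - two_cos)).
    by rewrite E1; split=> //; [rewrite mulr_gt0 | rewrite ltrDl mulr_gt0].
  exists a, (b * two_cos), (rho * a + b * two_cos + c * (2 * rho - two_cos)).
  by rewrite E2; split=> //; [rewrite mulr_gt0 | rewrite ltrDl mulr_gt0].
case=> -[a [b [h [a0 b0 hE ->]]]].
  exists (u_vec i), a, (b / two_cos), ((h - rho * a - b) / (2 * rho - two_cos)); split=> //.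
  - by left.
  - by rewrite divr_gt0.
  - by rewrite divr_gt0 //; lra.
  - by rewrite E1 !divfK ?lt0r_neq0 //; congr (line_of (sector_vec _ _ _ _)); ring.
exists (u_vec (ordS (ordS i))), a, (b / two_cos), ((h - rho * a - b) / (2 * rho - two_cos)); split=> //.
- by right.
- by rewrite divr_gt0.
- by rewrite divr_gt0 //; lra.
- by rewrite E2 !divfK ?lt0r_neq0 //; congr (line_of (sector_vec _ _ _ _)); ring.
Qed.

Lemma sector_vec_neq0 i a b h : [|| a != 0, b != 0 | h != 0] -> sector_vec i a b h != 0.
Proof. by apply: contraTneq => /sector_vec_free[-> -> ->]; rewrite eqxx. Qed.

Lemma hub_face_not_drawn i : hub_face i `<=` ~` D.
Proof.
have r1 := rho_gt1; have r0 := rho_gt0.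
move=> x /hub_interior[] [a [b [h [a0 b0 hE ->]]]]; apply: not_in_drawing.
- by rewrite mulr_ge0 // ltW.
- by apply: sector_vec_neq0; rewrite (lt0r_neq0 b0) orbT.
- have ra : 0 <= rho * a by rewrite mulr_ge0 // ltW.
  have rb : 0 < rho * b by rewrite mulr_gt0.
  by case=> [[] ?|[[? _]|[? ?]]]; [lra|lra|lra|lra|nra].
- by rewrite mulrNN mulr_ge0 // ltW.
- by apply: sector_vec_neq0; rewrite oppr_eq0 (lt0r_neq0 b0).
- have ra : 0 <= rho * a by rewrite mulr_ge0 // ltW.
  have rb : 0 < rho * b by rewrite mulr_gt0.
  by case=> [[] ?|[[? ?]|[? _]]]; [lra|lra|lra|nra|lra].
Qed.

(** The weights of [u_(i+1)] and of the opposite of [v_(i+1)] in the face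
    [v_i u_(i+1) v_(i+2) v_(i+1)]: they solve [x + y = c] and [x rho - y = 2]. *)
Definition rim_u_weight : R := (two_cos + 2) / (rho + 1).
Definition rim_v_weight : R := two_cos - rim_u_weight.
Let rim_u_weight_gt0 : 0 < rim_u_weight. Proof. have r := rho_gt0; have c := two_cos_gt0; rewrite /rim_u_weight divr_gt0; lra. Qed.
Let rim_u_weightE : rim_u_weight * (rho + 1) = two_cos + 2.
Proof. by rewrite /rim_u_weight divfK // lt0r_neq0 //; have r := rho_gt0; lra. Qed.
Let rim_v_weight_gt0 : 0 < rim_v_weight.
Proof.
have r := rho_gt0; have E := rim_u_weightE; have rc := rho_two_cos.
have : 0 < rim_v_weight * (rho + 1) by rewrite /rim_v_weight mulrBl E; lra.
by rewrite pmulr_lgt0 //; lra.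
Qed.

Definition rim_face i := quad_interior (v_vec i) (rim_u_weight *: u_vec (ordS i)) (v_vec (ordS (ordS i))) (rim_v_weight *: - v_vec (ordS i)).

Lemma rim_diagonals i : v_vec i + v_vec (ordS (ordS i)) = rim_u_weight *: u_vec (ordS i) + rim_v_weight *: - v_vec (ordS i).
Proof.
have [rx ry] := u_rec R i; have E := rim_u_weightE.
apply/rowP => l; rewrite !mxE; case: l => -[|[|[|//]]] ? /=; rewrite ?mul1r ?mul0r ?subr0.
- by rewrite !mulN1r -opprD rx /rim_v_weight; ring.
- by rewrite !mulN1r -opprD ry /rim_v_weight; ring.
- by rewrite /rim_v_weight; lra.
Qed.

(** The half of the face next to [v_i] is, up to sign, the part of sector [i]
    between the edges [v_i v_(i+1)] and [v_i u_(i+1)], and the other half is the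
    part of sector [i + 1] between [v_(i+1) v_(i+2)] and [u_(i+1) v_(i+2)]. *)
Lemma rim_interior i x : rim_face i x <->
  (exists a b h, [/\ 0 <= a, 0 < b, a - b < h < a + rho * b & x = line_of (sector_vec i (- a) (- b) h)]) \/
  (exists a b h, [/\ 0 <= a, 0 < b, a - b < h < a + rho * b & x = line_of (sector_vec (ordS i) b a h)]).
Proof.
have r1 := rho_gt1; have b0 := rim_u_weight_gt0; have d0 := rim_v_weight_gt0.
have E1 a b c : a *: v_vec i + b *: (rim_u_weight *: u_vec (ordS i)) + c *: (rim_v_weight *: - v_vec (ordS i)) =
    sector_vec i (- a) (- (b * rim_u_weight + c * rim_v_weight)) (a + rho * (b * rim_u_weight) - c * rim_v_weight).
  by rewrite u_vec_shift v_vec_shift !(sector_vec_opp, sector_vec_scale, sector_vec_add); congr sector_vec; ring.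
have E2 a b c : a *: v_vec (ordS (ordS i)) + b *: (rim_u_weight *: u_vec (ordS i)) + c *: (rim_v_weight *: - v_vec (ordS i)) =
    sector_vec (ordS i) (b * rim_u_weight + c * rim_v_weight) a (a + rho * (b * rim_u_weight) - c * rim_v_weight).
  by rewrite (v_vec_shift (ordS i)) !(sector_vec_opp, sector_vec_scale, sector_vec_add); congr sector_vec; ring.
have pos a b c : 0 < b -> 0 < c -> 0 < b * rim_u_weight + c * rim_v_weight /\
    a - (b * rim_u_weight + c * rim_v_weight) < a + rho * (b * rim_u_weight) - c * rim_v_weight < a + rho * (b * rim_u_weight + c * rim_v_weight).
  move=> b_gt0 c_gt0; have B0 : 0 < b * rim_u_weight by rewrite mulr_gt0.
  have C0 : 0 < c * rim_v_weight by rewrite mulr_gt0.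
  have rB : 0 < rho * (b * rim_u_weight) by nra.
  have rC : 0 < rho * (c * rim_v_weight) by nra.
  by split; [lra | apply/andP; split; lra].
have inv a b h : 0 < b -> a - b < h < a + rho * b ->
    let b' := (h - a + b) / (rho + 1) in
    [/\ 0 < b' / rim_u_weight, 0 < (b - b') / rim_v_weight,
      b' / rim_u_weight * rim_u_weight + (b - b') / rim_v_weight * rim_v_weight = b &
      a + rho * (b' / rim_u_weight * rim_u_weight) - (b - b') / rim_v_weight * rim_v_weight = h].
  move=> b_gt0 /andP[hl hr] b'; have bE : b' * (rho + 1) = h - a + b.
    by rewrite divfK // lt0r_neq0; lra.
  rewrite !divfK ?lt0r_neq0 //; split; [|apply: divr_gt0 => //|ring|lra].
    by apply: divr_gt0 => //; apply: divr_gt0; lra.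
  by have : 0 < (b - b') * (rho + 1) by [lra]; rewrite pmulr_lgt0 //; lra.
split.
  move=> [P [a [b [c [[]-> a0 bp cp ->]]]]]; have [p1 p2] := pos a b c bp cp; [left|right].
    by rewrite E1; exists a, (b * rim_u_weight + c * rim_v_weight), (a + rho * (b * rim_u_weight) - c * rim_v_weight).
  by rewrite E2; exists a, (b * rim_u_weight + c * rim_v_weight), (a + rho * (b * rim_u_weight) - c * rim_v_weight).
case=> -[a [b [h [a0 bp hE ->]]]]; have [i1 i2 i3 i4] := inv a b h bp hE.
  exists (v_vec i), a; do 2!eexists; split; [by left|by []|exact: i1|exact: i2|].
  by rewrite E1 i3 i4.
exists (v_vec (ordS (ordS i))), a; do 2!eexists; split; [by right|by []|exact: i1|exact: i2|].
by rewrite E2 i3 i4.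
Qed.

Lemma rim_face_not_drawn i : rim_face i `<=` ~` D.
Proof.
have r1 := rho_gt1; have r0 := rho_gt0.
move=> x /rim_interior[] [a [b [h [a0 b0 /andP[hl hr] ->]]]]; apply: not_in_drawing.
- by rewrite mulrNN mulr_ge0 // ltW.
- by apply: sector_vec_neq0; rewrite !oppr_eq0 (lt0r_neq0 b0) orbT.
- have ra : 0 <= rho * a by rewrite mulr_ge0 // ltW.
  have rb : 0 < rho * b by rewrite mulr_gt0.
  by case=> [[] ?|[[? _]|[? ?]]]; [nra|lra|lra|lra|nra].
- by rewrite mulr_ge0 // ltW.
- by apply: sector_vec_neq0; rewrite (lt0r_neq0 b0).
- have ra : 0 <= rho * a by rewrite mulr_ge0 // ltW.
  have rb : 0 < rho * b by rewrite mulr_gt0.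
  by case=> [[] ?|[[? ?]|[? _]]]; [nra|lra|lra|nra|lra].
Qed.

(** For [a, b >= 0] the heights [rho a + b], [b - a] and [- a - rho b] cut sector
    [i] into four pieces, one half of a face in each. *)
Lemma faces_cover i a b h : 0 <= a * b -> ~ drawn a b h ->
  exists j, hub_face j (line_of (sector_vec i a b h)) \/ rim_face j (line_of (sector_vec i a b h)).
Proof.
have r1 := rho_gt1; have r0 := rho_gt0.
wlog [a0 b0] : a b h / 0 <= a /\ 0 <= b => [H ab nd|_ nd].
  have [ab0|nn] := pselect (0 <= a /\ 0 <= b); first exact: H.
  have [a0 b0] : a <= 0 /\ b <= 0.
    by have [a0|a0] := lerP a 0; have [b0|b0] := lerP b 0; split=> //; nra.
  rewrite -line_ofN sector_vec_opp; apply: H; rewrite ?mulrNN ?oppr_ge0 //.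
  by move/(drawn_scale (-1)); rewrite !mulN1r !opprK.
have nd1 : h != rho * a + b by apply/eqP => hE; apply: nd; left; constructor 1.
have nd2 : h != b - a by apply/eqP => hE; apply: nd; left; constructor 2.
have nd3 : h != - a - rho * b by apply/eqP => hE; apply: nd; left; constructor 3.
have nd4 : b = 0 -> h < rho * a.
  move=> bE; rewrite ltNge; apply/negP => le; apply: nd; right; left; split=> //.
  by rewrite expr2 mulrCA ler_wpM2l.
have nd5 : a = 0 -> - (rho * b) < h.
  move=> aE; rewrite ltNge; apply/negP => le; apply: nd; right; right; split=> //.
  by rewrite expr2 mulrCA -mulrN ler_wpM2l.
have ra : 0 <= rho * a by rewrite mulr_ge0 // ltW.
have rb : 0 <= rho * b by rewrite mulr_ge0 // ltW.
have [h1|h1|/eqP] := ltgtP h (rho * a + b); last by rewrite (negbTE nd1).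
  have [h2|h2|/eqP] := ltgtP h (b - a); last by rewrite (negbTE nd2).
    have [h3|h3|/eqP] := ltgtP h (- a - rho * b); last by rewrite (negbTE nd3).
      exists (ord_pred i); left; apply/hub_interior; right; rewrite ord_predK.
      exists b, a, (- h); split; [by []| |lra|by rewrite -line_ofN sector_vec_opp].
      rewrite lt_neqAle a0 andbT; apply/eqP => /esym aE; have := nd5 aE; lra.
    exists i; right; apply/rim_interior; left.
    exists a, b, (- h); split; [by []| |apply/andP; split; lra|by rewrite -line_ofN sector_vec_opp].
    rewrite lt_neqAle b0 andbT; apply/eqP => /esym bE; rewrite bE mulr0 in h2 h3; lra.
  exists (ord_pred i); right; apply/rim_interior; right; rewrite ord_predK.
  exists b, a, h; split; [by []| |apply/andP; split; lra|by []].
  rewrite lt_neqAle a0 andbT; apply/eqP => /esym aE; rewrite aE mulr0 in h1 h2; lra.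
exists i; left; apply/hub_interior; left; exists a, b, h; split=> //.
rewrite lt_neqAle b0 andbT; apply/eqP => /esym bE; have := nd4 bE; lra.
Qed.

Lemma multiwheel_quadrangulates : quadrangulates R (projective_plane R) M.
Proof.
exists vertex_pt, arc_of; split; first exact: multiwheel_embedding.
have n1 i : ordS i == i = false by apply/negbTE/ordS_neq; lia.
have n2 i : ordS (ordS i) == i = false by apply/negbTE/ordS2_neq; lia.
move=> x nDx; have [v v0 xv] := line_of_surj x.
have [i [a [b [h [ab vE]]]]] := sector_vec_cover v.
have nd : ~ drawn a b h.
  by move=> dr; apply: nDx; rewrite xv vE; apply: drawn_drawing => //; rewrite -vE.
have [j] := faces_cover i ab nd; rewrite -vE -xv.
have r1 := rho_gt1; have r0 := rho_gt0; have hc := hub_weight_gt0.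
have c0 := two_cos_gt0; have b0 := rim_u_weight_gt0; have d0 := rim_v_weight_gt0.
case=> [/= hx|/= hx].
- apply: (quad_face_cycle (x0 := mw_u j) (x1 := mw_v (ordS j)) (x2 := mw_u (ordS (ordS j)))
    (x3 := mw_z q) (hub_diagonals j)) hx.
  + move=> a' b' c'; rewrite (z_vecE j) v_vec_shift !(sector_vec_scale, sector_vec_add) => /sector_vec_free[].
    rewrite !mulr0 !mulr1 !addr0 add0r => -> /eqP + /eqP.
    rewrite mulf_eq0 (gt_eqF c0) orbF => /eqP ->; rewrite !mul0r !add0r mulf_eq0 (gt_eqF hc) orbF.
    by move/eqP->.
  + rewrite /ucycle /= !multiwheel_adj //= /consec !eqxx ?orbT.
    by rewrite !inE /= /mw_u /mw_v !(inj_eq Some_inj) /eq_op /= eq_sym n2.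
  + by rewrite (arc_tail_head (Rise j)) image_rise -[u_vec j in RHS]scale1r segment_scale.
  + by rewrite (arc_tail_head (Fall (ordS j))) image_fall -[u_vec _ in RHS]scale1r segment_scale.
  + by rewrite (arc_head_tail (Spoke (ordS (ordS j)))) image_spoke segmentC -[u_vec _ in RHS]scale1r segment_scale.
  + by rewrite (arc_tail_head (Spoke j)) image_spoke -[u_vec _ in RHS]scale1r segment_scale.
  + exact: hub_face_not_drawn.
- apply: (quad_face_cycle (x0 := mw_v j) (x1 := mw_u (ordS j)) (x2 := mw_v (ordS (ordS j)))
    (x3 := mw_v (ordS j)) (rim_diagonals j)) hx.
  + move=> a' b' c'; rewrite u_vec_shift v_vec_shift !(sector_vec_opp, sector_vec_scale, sector_vec_add) => /sector_vec_free[aE bE hE].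
    have {aE} aE : a' = 0 by lra.
    have be0 : b' * rim_u_weight * (rho + 1) = 0 by rewrite aE in hE; lra.
    have bE0 : b' = 0.
      apply/eqP; move/eqP: be0; rewrite mulf_eq0 (mulf_eq0 b') (gt_eqF b0) orbF => /orP[//|/eqP]; lra.
    split=> //; apply/eqP; rewrite bE0 in bE; have /eqP : c' * rim_v_weight = 0 by lra.
    by rewrite mulf_eq0 (gt_eqF d0) orbF.
  + rewrite /ucycle /= !multiwheel_adj //= /consec !eqxx ?orbT.
    by rewrite !inE /= /mw_u /mw_v !(inj_eq Some_inj) /eq_op /= ![j == _]eq_sym n2 !n1.
  + by rewrite (arc_tail_head (Fall j)) image_fall -[v_vec j in RHS]scale1r segment_scale.
  + by rewrite (arc_tail_head (Rise (ordS j))) image_rise -[v_vec _ in RHS]scale1r segment_scale.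
  + rewrite (arc_head_tail (Rim (ordS j))) image_rim segmentC -segmentN opprK.
    by rewrite -[v_vec (ordS (ordS j)) in RHS]scale1r segment_scale // segmentC.
  + by rewrite (arc_head_tail (Rim j)) image_rim segmentC -[v_vec j in RHS]scale1r segment_scale.
  + exact: rim_face_not_drawn.
Qed.

End Drawing.

Theorem lemma6 (R : realType) (q : nat) (hq : (0 < q)%N) :
  four_critical (multiwheel q) /\
  quadrangulates_projective_plane R (multiwheel q).
Proof.
split; first exact: multiwheel_four_critical.
exact: multiwheel_quadrangulates.
Qed.
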